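(* Let $Q$ and $Q'$ be two quivers with the same vertex set $I$ and the same underlying undirected graph (i.e. $Q'$ is obtained from $Q$ by reversing some arrows), and fix arbitrary total orderings at each vertex for $\bar Q$ and for $\bar Q'$. Then the quasi-Hamiltonian algebras $(A_Q,\{\!\{-,-\}\!\},\Phi)$ and $(A_{Q'},\{\!\{-,-\}\!\}',\Phi')$ described in the context are isomorphic as quasi-Hamiltonian algebras over $B=\bigoplus_{s\in I}\Bbbk e_s$. In particular, up to isomorphism, this quasi-Hamiltonian algebra only depends on $Q$ seen as an undirected graph.
   Context: $\Bbbk$ is a field of characteristic $0$, $\otimes=\otimes_\Bbbk$, algebras are associative, unital, finitely generated. $B=\bigoplus_{s\in I}\Bbbk e_s$ with orthogonal idempotents summing to $1$; a $B$-algebra is an algebra with a map $B\to A$. Sweedler notation $d=d'\otimes d''$, $(d'\otimes d'')^\circ=d''\otimes d'$, outer bimodule structure $a(d'\otimes d'')b=ad'\otimes d''b$. A ($B$-linear) double bracket is a bilinear map $\{\!\{-,-\}\!\}:A\times A\to A\otimes A$ with $\{\!\{a,b\}\!\}=-\{\!\{b,a\}\!\}^\circ$, $\{\!\{a,bc\}\!\}=\{\!\{a,b\}\!\}c+b\{\!\{a,c\}\!\}$, vanishing if an argument lies in $B$. Its triple bracket: $\{\!\{a,b,c\}\!\}=\{\!\{a,\{\!\{b,c\}\!\}'\}\!\}\otimes\{\!\{b,c\}\!\}''+\tau(\{\!\{b,\{\!\{c,a\}\!\}'\}\!\}\otimes\{\!\{c,a\}\!\}'')+\tau^2(\{\!\{c,\{\!\{a,b\}\!\}'\}\!\}\otimes\{\!\{a,b\}\!\}'')$,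 $\tau(a_1\otimes a_2\otimes a_3)=a_3\otimes a_1\otimes a_2$. It is a double quasi-Poisson bracket if for all $a,b,c$: $\{\!\{a,b,c\}\!\}=\frac14\sum_{s\in I}\big(ce_sa\otimes e_sb\otimes e_s-ce_sa\otimes e_s\otimes be_s-ce_s\otimes ae_sb\otimes e_s+ce_s\otimes ae_s\otimes be_s-e_sa\otimes e_sb\otimes e_sc+e_sa\otimes e_s\otimes be_sc+e_s\otimes ae_sb\otimes e_sc-e_s\otimes ae_s\otimes be_sc\big)$. A multiplicative moment map is an invertible $\Phi=\sum_s\Phi_s$, $\Phi_s\in e_sAe_s$, with $\{\!\{\Phi_s,a\}\!\}=\frac12(ae_s\otimes\Phi_s-e_s\otimes\Phi_sa+a\Phi_s\otimes e_s-\Phi_s\otimes e_sa)$ for all $a\in A$, $s\in I$; a quasi-Hamiltonian algebra is $(A,\{\!\{-,-\}\!\},\Phi)$ with a double quasi-Poisson bracket and a multiplicative moment map. An isomorphism of quasi-Hamiltonian algebras is a $B$-algebra isomorphism $\psi$ with $\{\!\{\psi a,\psi b\}\!\}_2=(\psi\otimes\psi)\{\!\{a,b\}\!\}_1$ and $\psi(\Phi_1)=\Phi_2$. Quivers: arrows $a:t(a)\to h(a)$, double $\bar Q$ adds $a^*:h(a)\to t(a)$, $(a^* )^*=a$; path algebra with $a=e_{t(a)}ae_{h(a)}$, paths read left to right. $A_Q$ is the universal localisation of $\Bbbk\bar Q$ at $S=\{1+aa^*\mid a\in\bar Q\}$ (equivalently, adjoining inverses of $e_{t(a)}+aa^*$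 in $e_{t(a)}A_Qe_{t(a)}$). For each $s\in I$ fix a total order $<_s$ on $T_s=\{a\in\bar Q\mid t(a)=s\}$ and let $o_s(a,b)=1$ if $a<_sb$, $-1$ if $b<_sa$, and $0$ otherwise (i.e. if $a=b$ or $a\notin T_s$ or $b\notin T_s$). The double quasi-Poisson bracket on $A_Q$ is the $B$-linear double bracket determined by: $\{\!\{a,a\}\!\}=\frac12o_{t(a)}(a,a^* )(a^2\otimes e_{t(a)}-e_{h(a)}\otimes a^2)$ for $a\in\bar Q$; $\{\!\{a,a^*\}\!\}=e_{h(a)}\otimes e_{t(a)}+\frac12a^*a\otimes e_{t(a)}+\frac12e_{h(a)}\otimes aa^*+\frac12o_{t(a)}(a,a^* )(a^*\otimes a-a\otimes a^* )$ for $a\in Q$; and for $b,c\in\bar Q$ with $c\neq b,b^*$: $\{\!\{b,c\}\!\}=-\frac12o_{t(b)}(b,c)\,b\otimes c-\frac12o_{h(b)}(b^*,c^* )\,c\otimes b+\frac12o_{t(b)}(b,c^* )\,cb\otimes e_{t(b)}+\frac12o_{h(b)}(b^*,c)\,e_{h(b)}\otimes bc$. The multiplicative moment map is $\Phi=\sum_s\Phi_s$, $\Phi_s=\prod_{a\in T_s}(e_s+aa^* )^{\epsilon(a)}$, the product taken from left to right in increasing order for $<_s$, with $\epsilon(a)=+1$ if $a\in Q$ and $-1$ if $a\in\bar Q\setminus Q$. *)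

(* Defs.v *)
From HB Require Import structures.
From mathcomp Require Import all_boot all_order all_algebra.
Set Implicit Arguments.
Unset Strict Implicit.
Unset Printing Implicit Defensive.
Import GRing.Theory.
Local Open Scope ring_scope.

Section QHam.
Variable K : fieldType.

(* Algebraic tensor products A (x) A and A (x) A (x) A over K.          *)
(* An element is represented by a finite formal sum of simple tensors   *)
(* (a seq of pairs/triples); two formal sums are equal in the tensor    *)
(* product iff every K-bilinear (resp. trilinear) map into any K-vector *)
(* space takes the same value on them (universal property of the        *)
(* tensor product, i.e. equality in F(A x A)/(bilinearity relations)).  *)
(* Triples (a1,a2,a3) are encoded as ((a1,a2),a3).                      *)

Definition bilin (A : algType K) (W : lmodType K) (f : A -> A -> W) :=
  (forall c x x' y, f (c *: x + x') y = c *: f x y + f x' y) /\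
  (forall c x y y', f x (c *: y + y') = c *: f x y + f x y').

Definition trilin (A : algType K) (W : lmodType K) (f : A -> A -> A -> W) :=
  [/\ (forall c x x' y z, f (c *: x + x') y z = c *: f x y z + f x' y z),
      (forall c x y y' z, f x (c *: y + y') z = c *: f x y z + f x y' z) &
      (forall c x y z z', f x y (c *: z + z') = c *: f x y z + f x y z')].

Definition eq2 (A : algType K) (s t : seq (A * A)) : Prop :=
  forall (W : lmodType K) (f : A -> A -> W), bilin f ->
    \sum_(p <- s) f p.1 p.2 = \sum_(p <- t) f p.1 p.2.

Definition eq3 (A : algType K) (s t : seq (A * A * A)) : Prop :=
  forall (W : lmodType K) (f : A -> A -> A -> W), trilin f ->
    \sum_(p <- s) f p.1.1 p.1.2 p.2 = \sum_(p <- t) f p.1.1 p.1.2 p.2.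

Section Ops.
Variable A : algType K.
Definition sc2 (c : K) (s : seq (A * A)) := [seq (c *: p.1, p.2) | p <- s].
Definition sc3 (c : K) (s : seq (A * A * A)) :=
  [seq (c *: p.1.1, p.1.2, p.2) | p <- s].
Definition sw2 (s : seq (A * A)) := [seq (p.2, p.1) | p <- s].
Definition lm2 (b : A) (s : seq (A * A)) := [seq (b * p.1, p.2) | p <- s].
Definition rm2 (s : seq (A * A)) (c : A) := [seq (p.1, p.2 * c) | p <- s].
Definition tau3 (s : seq (A * A * A)) := [seq (p.2, p.1.1, p.1.2) | p <- s].

Definition invertible (x : A) := exists y : A, x * y = 1 /\ y * x = 1.

Definition is_alg_hom (R : algType K) (g : A -> R) :=
  [/\ forall c x y, g (c *: x + y) = c *: g x + g y,
      forall x y, g (x * y) = g x * g y & g 1 = 1].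

Variable I : finType.

(* B = (+)_{s in I} K e_s : a B-algebra structure on A *)
Definition is_Bsys (e : I -> A) :=
  (forall s s', e s * e s' = if s == s' then e s else 0) /\ \sum_s e s = 1.

Definition double_bracket (e : I -> A) (br : A -> A -> seq (A * A)) :=
  [/\ forall c a a' b, eq2 (br (c *: a + a') b) (sc2 c (br a b) ++ br a' b),
      forall c a b b', eq2 (br a (c *: b + b')) (sc2 c (br a b) ++ br a b'),
      forall a b, eq2 (br a b) (sc2 (-1) (sw2 (br b a))),
      forall a b c, eq2 (br a (b * c)) (rm2 (br a b) c ++ lm2 b (br a c)) &
      forall (l : I -> K) a, eq2 (br (\sum_s l s *: e s) a) [::] /\
                             eq2 (br a (\sum_s l s *: e s)) [::]].

Definition trip_part (br : A -> A -> seq (A * A)) (a : A) (s : seq (A * A)) :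
  seq (A * A * A) :=
  flatten [seq [seq (q.1, q.2, p.2) | q <- br a p.1] | p <- s].

Definition triple_bracket (br : A -> A -> seq (A * A)) (a b c : A) :=
  trip_part br a (br b c) ++ tau3 (trip_part br b (br c a))
  ++ tau3 (tau3 (trip_part br c (br a b))).

Definition qP_rhs (e : I -> A) (a b c : A) : seq (A * A * A) :=
  sc3 (1 / 4) (flatten [seq
    [:: (c * e s * a, e s * b, e s);
        ((-1) *: (c * e s * a), e s, b * e s);
        ((-1) *: (c * e s), a * e s * b, e s);
        (c * e s, a * e s, b * e s);
        ((-1) *: (e s * a), e s * b, e s * c);
        (e s * a, e s, b * e s * c);
        (e s, a * e s * b, e s * c);
        ((-1) *: e s, a * e s, b * e s * c)] | s <- enum I]).

Definition double_quasi_Poisson (e : I -> A) br :=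
  double_bracket e br /\
  forall a b c, eq3 (triple_bracket br a b c) (qP_rhs e a b c).

(* Phi = \sum_s Phi_s, given by its components Phi_s in e_s A e_s *)
Definition mult_moment_map (e : I -> A) br (Phi : I -> A) :=
  [/\ forall s, Phi s = e s * Phi s * e s,
      invertible (\sum_s Phi s) &
      forall s a, eq2 (br (Phi s) a)
        [:: ((1/2) *: (a * e s), Phi s); ((-(1/2)) *: e s, Phi s * a);
            ((1/2) *: (a * Phi s), e s); ((-(1/2)) *: Phi s, e s * a)]].

Definition quasi_Hamiltonian (e : I -> A) br Phi :=
  double_quasi_Poisson e br /\ mult_moment_map e br Phi.

End Ops.

Definition qHam_iso (I : finType) (A1 A2 : algType K)
  (e1 : I -> A1) (br1 : A1 -> A1 -> seq (A1 * A1)) (Phi1 : I -> A1)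
  (e2 : I -> A2) (br2 : A2 -> A2 -> seq (A2 * A2)) (Phi2 : I -> A2)
  (psi : A1 -> A2) :=
  [/\ is_alg_hom psi, bijective psi, forall s, psi (e1 s) = e2 s,
      forall a b, eq2 (br2 (psi a) (psi b))
                      [seq (psi p.1, psi p.2) | p <- br1 a b] &
      psi (\sum_s Phi1 s) = \sum_s Phi2 s].

Section Quiver.
Variables (I Ar : finType) (tQ hQ : Ar -> I).

(* arrows of the double quiver: (a,false) = a in Q, (a,true) = a^star *)
Definition dbl := (Ar * bool)%type.
Definition dstar (a : dbl) : dbl := (a.1, ~~ a.2).
Definition dt (a : dbl) : I := if a.2 then hQ a.1 else tQ a.1.
Definition dh (a : dbl) : I := if a.2 then tQ a.1 else hQ a.1.

(* a total order <_s on T_s = {a | t(a) = s}, given as the increasing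
   enumeration ord s of T_s *)
Definition vertex_orders (ord : I -> seq dbl) :=
  forall s, uniq (ord s) /\ forall a, (a \in ord s) = (dt a == s).

Definition ordo (ord : I -> seq dbl) (s : I) (a b : dbl) : K :=
  if [&& a \in ord s, b \in ord s & a != b] then
    (if (index a (ord s) < index b (ord s))%N then 1 else -1)
  else 0.

Section Alg.
Variable A : algType K.

Definition quiver_gens (R : algType K) (f : I -> R) (y : dbl -> R) :=
  forall a, y a = f (dt a) * y a * f (dh a).

Definition corner_inv (R : algType K) (f : I -> R) (y w : dbl -> R) :=
  forall a, [/\ w a = f (dt a) * w a * f (dt a),
    (f (dt a) + y a * y (dstar a)) * w a = f (dt a) &
    w a * (f (dt a) + y a * y (dstar a)) = f (dt a)].

(* (A, e, x, w) is the universal localisation A_Q of the path algebra of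
   the double quiver (as a B-algebra) at the elements e_{t(a)} + a a^star
   (inverted in e_{t(a)} A e_{t(a)}); x a is the image of the arrow a *)
Definition is_AQ (e : I -> A) (x w : dbl -> A) :=
  [/\ is_Bsys e, quiver_gens e x, corner_inv e x w &
    forall (R : algType K) (f : I -> R) (y : dbl -> R),
      is_Bsys f -> quiver_gens f y -> (exists w', corner_inv f y w') ->
      exists g : A -> R,
        [/\ is_alg_hom g, (forall s, g (e s) = f s), (forall a, g (x a) = y a) &
          forall g' : A -> R, is_alg_hom g' -> (forall s, g' (e s) = f s) ->
            (forall a, g' (x a) = y a) -> g' =1 g]].

Definition quiver_bracket (e : I -> A) (x : dbl -> A) (ord : I -> seq dbl)
  (br : A -> A -> seq (A * A)) :=
  [/\ (forall a : dbl,
        let o := ordo ord (dt a) a (dstar a) in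
        eq2 (br (x a) (x a))
          [:: ((1/2 * o) *: (x a * x a), e (dt a));
              ((-(1/2 * o)) *: e (dh a), x a * x a)]),
      (forall a0 : Ar,
        let a := (a0, false) in
        let o := ordo ord (dt a) a (dstar a) in
        eq2 (br (x a) (x (dstar a)))
          [:: (e (dh a), e (dt a));
              ((1/2) *: (x (dstar a) * x a), e (dt a));
              ((1/2) *: e (dh a), x a * x (dstar a));
              ((1/2 * o) *: x (dstar a), x a);
              ((-(1/2 * o)) *: x a, x (dstar a))]) &
      (forall b c : dbl, c != b -> c != dstar b ->
        eq2 (br (x b) (x c))
          [:: ((-(1/2 * ordo ord (dt b) b c)) *: x b, x c);
              ((-(1/2 * ordo ord (dh b) (dstar b) (dstar c))) *: x c, x b);
              ((1/2 * ordo ord (dt b) b (dstar c)) *: (x c * x b), e (dt b));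
              ((1/2 * ordo ord (dh b) (dstar b) c) *: e (dh b), x b * x c)])].

(* Phi_s = prod_{a in T_s, increasing} (e_s + a a^star)^{eps(a)},
   the product taken inside e_s A e_s (empty product = e_s) *)
Definition PhiQ (e : I -> A) (x w : dbl -> A) (ord : I -> seq dbl) (s : I) : A :=
  e s * \prod_(a <- ord s) (if a.2 then w a else e s + x a * x (dstar a)).

End Alg.
End Quiver.

End QHam.

(* Main.v *)
Require Import Defs.
From HB Require Import structures.
From mathcomp Require Import all_boot all_order all_algebra.
From mathcomp Require Import boolp zify ring.
(** Fix the algebra [A] with its bracket and its moment map and change only the
    generators. For a half-edge [a] let [phi_a = (1 + a a* )^eps(a)]; then
    {{phi_a, -}} is the moment map formula localised at [a], up to the signs of
    the order. Two moves rewrite a presentation of [A] by [(Q, <)].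

    - If [a < b] are consecutive at a vertex, replacing [b] by [phi_a b] and [b*]
      by [b* phi_a^-1] gives a presentation for the order where [a] and [b] are
      exchanged: the new factor at [b] is [phi_a phi_b phi_a^-1], so that [Phi] is
      unchanged.
    - If [a] is an arrow of [Q], replacing [a] by [- (1 + a a* )^-1 a] gives a
      presentation for the quiver with [a] reversed: [1 + a a*] and [1 + a* a]
      turn into their inverses, so that [Phi] is unchanged.

    Any two orders and orientations are linked by such moves, and two algebras
    with the same presentation are isomorphic by the universal property. *)

Set Implicit Arguments.
Unset Strict Implicit.
Unset Printing Implicit Defensive.
Import GRing.Theory.
Local Open Scope ring_scope.

(** * Square-zero extensions of the base field *)

Section SquareZero.
Variables (K : fieldType) (W : lmodType K).

Definition sqzero : Type := (K * W)%type.
HB.instance Definition _ := GRing.Zmodule.copy sqzero (K * W)%type.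

Definition sqzero_mul (p q : sqzero) : sqzero :=
  (p.1 * q.1, p.1 *: q.2 + q.1 *: p.2).

Fact sqzero_mulA : associative sqzero_mul.
Proof.
move=> [a u] [b v] [c z]; rewrite /sqzero_mul /=; congr (_, _).
  by rewrite mulrA.
by rewrite !scalerDr !scalerA addrA (mulrC c a) (mulrC c b).
Qed.

Fact sqzero_mulC : commutative sqzero_mul.
Proof. by move=> [a u] [b v]; rewrite /sqzero_mul /= mulrC addrC. Qed.

Fact sqzero_mul1 : left_id ((1, 0) : sqzero) sqzero_mul.
Proof. by move=> [a u]; rewrite /sqzero_mul /= mul1r scale1r scaler0 addr0. Qed.

Fact sqzero_mulD : left_distributive sqzero_mul +%R.
Proof.
move=> [a u] [b v] [c z]; rewrite /sqzero_mul /=; congr (_, _) => /=.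
  by rewrite mulrDl.
by rewrite scalerDl scalerDr addrACA.
Qed.

Fact sqzero_oner_neq0 : ((1, 0) : sqzero) != 0.
Proof. by apply/eqP => -[] /eqP; rewrite oner_eq0. Qed.

HB.instance Definition _ := GRing.Zmodule_isComNzRing.Build sqzero
  sqzero_mulA sqzero_mulC sqzero_mul1 sqzero_mulD sqzero_oner_neq0.

Definition sqzero_scal (k : K) : sqzero := (k, 0).
Definition sqzero_vec (z : W) : sqzero := (0, z).

Fact sqzero_scal_is_zmod_morphism : zmod_morphism sqzero_scal.
Proof. by move=> a b; congr (_, _); rewrite /= subr0. Qed.
HB.instance Definition _ :=
  GRing.isZmodMorphism.Build K sqzero sqzero_scal sqzero_scal_is_zmod_morphism.

Fact sqzero_scal_is_monoid_morphism : monoid_morphism sqzero_scal.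
Proof. by split=> // a b; congr (_, _); rewrite /= !scaler0 addr0. Qed.
HB.instance Definition _ :=
  GRing.isMonoidMorphism.Build K sqzero sqzero_scal
    sqzero_scal_is_monoid_morphism.

Lemma sqzero_vec0 : sqzero_vec 0 = 0.
Proof. by []. Qed.

Lemma sqzero_vecD z z' : sqzero_vec (z + z') = sqzero_vec z + sqzero_vec z'.
Proof. by congr (_, _); rewrite /= addr0. Qed.

Lemma sqzero_vecN z : sqzero_vec (- z) = - sqzero_vec z.
Proof. by congr (_, _); rewrite /= oppr0. Qed.

Lemma sqzero_vec_inj : injective sqzero_vec.
Proof. by move=> z z' []. Qed.

Lemma sqzero_vecZ k z : sqzero_vec (k *: z) = sqzero_scal k * sqzero_vec z.
Proof. by congr (_, _); rewrite /= ?mulr0 // scale0r addr0. Qed.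

Definition sqzero_vecE := (sqzero_vec0, sqzero_vecD, sqzero_vecN, sqzero_vecZ).
End SquareZero.

(* Linear identities with scalar coefficients in a vector space [W] become
   polynomial ones in the square-zero extension [K (+) W]. *)
Ltac lmod_ring :=
  rewrite ?mulr0n ?mulr1n; apply: sqzero_vec_inj; rewrite ?sqzero_vecE; ring.

(** * Half-edges, and systems of generators with their inverses *)

Section HalfEdges.
Variables (K : fieldType) (I Ar : finType) (tl : dbl Ar -> I).

Lemma dstarK : involutive (@dstar Ar).
Proof. by case=> a s; rewrite /dstar /= negbK. Qed.

Lemma dstar_neq (a : dbl Ar) : (dstar a == a) = false.
Proof. by case: a => a s; rewrite xpair_eqE eqxx /=; case: s. Qed.

Lemma eq_dstar (a b : dbl Ar) : (dstar a == dstar b) = (a == b).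
Proof. exact: (inj_eq (can_inj dstarK)). Qed.

Lemma eq_dstarl (a b : dbl Ar) : (dstar a == b) = (a == dstar b).
Proof. by rewrite -(eq_dstar a) dstarK. Qed.

(* Only the tails [tl c] of the half-edges [c] matter here: the orientation of
   the quiver is recorded separately by a sign [eps], with [eps c = true] for
   the starred arrows. *)
Definition quiver_system (R : algType K) (f : I -> R) (y v : dbl Ar -> R) :=
  [/\ is_Bsys f,
      forall c, y c = f (tl c) * y c * f (tl (dstar c)) &
      forall c, [/\ v c = f (tl c) * v c * f (tl c),
        (f (tl c) + y c * y (dstar c)) * v c = f (tl c) &
        v c * (f (tl c) + y c * y (dstar c)) = f (tl c)]].

Definition unit_elt (R : algType K) (f : I -> R) (y : dbl Ar -> R) c :=
  f (tl c) + y c * y (dstar c).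

Definition unit_pow (R : algType K) (f : I -> R) (y v : dbl Ar -> R)
  (s : bool) c := if s then v c else unit_elt f y c.

(* The change of generators that exchanges the adjacent half-edges [a] and [b]
   in the order at their common vertex. *)
Definition swap_gen (R : algType K) (f : I -> R) (y v : dbl Ar -> R) (s : bool)
    (a b c : dbl Ar) :=
  if c == b then unit_pow f y v s a * y b
  else if c == dstar b then y (dstar b) * unit_pow f y v (~~ s) a else y c.

Definition swap_inv (R : algType K) (f : I -> R) (y v : dbl Ar -> R) (s : bool)
    (a b c : dbl Ar) :=
  if c == b then unit_pow f y v s a * v b * unit_pow f y v (~~ s) a else v c.

(* The change of generators that reverses the arrow [a]. *)
Definition flip_gen (R : algType K) (y v : dbl Ar -> R) (a c : dbl Ar) :=
  if c == a then - (v a * y a) else y c.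

Definition flip_inv (R : algType K) (f : I -> R) (y v : dbl Ar -> R)
    (a c : dbl Ar) :=
  if (c == a) || (c == dstar a) then unit_elt f y c else v c.

Section System.
Variables (R : algType K) (f : I -> R) (y v : dbl Ar -> R).
Hypothesis S : quiver_system f y v.
Notation u := (unit_elt f y).
Notation g := (unit_pow f y v).

Lemma sys_ff s : f s * f s = f s.
Proof. by case: S => -[H _] _ _; rewrite H eqxx. Qed.

Lemma sys_fy c : f (tl c) * y c = y c.
Proof. by case: S => _ H _; rewrite H !mulrA sys_ff. Qed.

Lemma sys_yf c : y c * f (tl (dstar c)) = y c.
Proof. by case: S => _ H _; rewrite H -!mulrA sys_ff. Qed.

Lemma sys_ysf c : y (dstar c) * f (tl c) = y (dstar c).
Proof. by rewrite -{2}(dstarK c) sys_yf. Qed.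

Lemma sys_fu c : f (tl c) * u c = u c.
Proof. by rewrite mulrDr sys_ff mulrA sys_fy. Qed.

Lemma sys_uf c : u c * f (tl c) = u c.
Proof. by rewrite mulrDl sys_ff -mulrA sys_ysf. Qed.

Lemma sys_fv c : f (tl c) * v c = v c.
Proof. by case: S => _ _ /(_ c)[H _ _]; rewrite H !mulrA sys_ff. Qed.

Lemma sys_vf c : v c * f (tl c) = v c.
Proof. by case: S => _ _ /(_ c)[H _ _]; rewrite H -!mulrA sys_ff. Qed.

Lemma sys_uv c : u c * v c = f (tl c).
Proof. by case: S => _ _ /(_ c)[]. Qed.

Lemma sys_vu c : v c * u c = f (tl c).
Proof. by case: S => _ _ /(_ c)[]. Qed.

Lemma sys_fg s c : f (tl c) * g s c = g s c.
Proof. by case: s; [exact: sys_fv | exact: sys_fu]. Qed.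

Lemma sys_gf s c : g s c * f (tl c) = g s c.
Proof. by case: s; [exact: sys_vf | exact: sys_uf]. Qed.

Lemma sys_gN s c : g s c * g (~~ s) c = f (tl c).
Proof. by case: s; [exact: sys_vu | exact: sys_uv]. Qed.

Lemma sys_gNl s c : g (~~ s) c * g s c = f (tl c).
Proof. by rewrite -{2}(negbK s) sys_gN. Qed.

(** In the corner at [tl c] one has $z = z(uv) = (zu)v = v$. *)
Lemma sys_inv_uniq c z : z * f (tl c) = z -> z * u c = f (tl c) -> z = v c.
Proof. by move=> fz zu; rewrite -fz -(sys_uv c) mulrA zu sys_fv. Qed.

(** The classical formula for the inverse of $1 + y^* y$ in terms of the inverse $v$ of $1 + y y^*$,
    namely $1 - y^* v y$. Reversing an arrow relies on it. *)
Lemma sys_v_dstar c :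
  v (dstar c) = f (tl (dstar c)) - y (dstar c) * v c * y c.
Proof.
apply/esym/sys_inv_uniq.
  by rewrite mulrBl sys_ff -[_ * y c * _]mulrA sys_yf.
rewrite /unit_elt dstarK mulrDr mulrBl sys_ff -[_ * y c * _]mulrA sys_yf.
rewrite mulrBl !mulrA sys_fy.
have -> : y (dstar c) * v c * y c * y (dstar c) * y c =
          y (dstar c) * y c - y (dstar c) * v c * y c.
  transitivity (y (dstar c) * (v c * (u c - f (tl c))) * y c).
    by rewrite /unit_elt addrC addKr !mulrA.
  by rewrite mulrBr sys_vu sys_vf mulrBr mulrBl sys_ysf.
by rewrite subKr subrK.
Qed.

End System.

(** * The two changes of generators: new units and invertibility *)

Section Moves.
Variables (R : algType K) (f : I -> R) (y v : dbl Ar -> R).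
Hypothesis S : quiver_system f y v.

Section SwapSystem.
Variables (a b : dbl Ar) (s : bool).
Hypotheses (tab : tl a = tl b) (nab : a != b).
Notation y' := (swap_gen f y v s a b).
Notation v' := (swap_inv f y v s a b).

Lemma swap_gen_head : y' b = unit_pow f y v s a * y b.
Proof. by rewrite /swap_gen eqxx. Qed.

Lemma swap_gen_dstar : y' (dstar b) = y (dstar b) * unit_pow f y v (~~ s) a.
Proof. by rewrite /swap_gen dstar_neq eqxx. Qed.

Lemma swap_gen_other c : c != b -> c != dstar b -> y' c = y c.
Proof. by rewrite /swap_gen => /negPf-> /negPf->. Qed.

(** With $g$ the power of the unit at [a], the product $y_b y_{b^*}$ is conjugated by $g$, while in
    $y_{b^*} y_b$ the inner $g^{-1} g$ cancels. Hence only the unit at [b] changes. The case where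
    [a] is [dstar b] is included. *)
Lemma swap_unit c : unit_elt f y' c =
  if c == b then unit_pow f y v s a * unit_elt f y b * unit_pow f y v (~~ s) a
  else unit_elt f y c.
Proof.
rewrite /unit_elt; have [->|cb] := eqVneq c b.
  rewrite swap_gen_head swap_gen_dstar mulrDr mulrDl -tab (sys_gf S) (sys_gN S).
  by rewrite !mulrA.
have [->|cbs] := eqVneq c (dstar b).
  rewrite dstarK swap_gen_head swap_gen_dstar -mulrA.
  rewrite (mulrA (unit_pow _ _ _ (~~ s) a)).
  by rewrite (sys_gNl S) tab (sys_fy S).
by rewrite !swap_gen_other // ?eq_dstar // eq_dstarl.
Qed.

Lemma swap_pow t c : unit_pow f y' v' t c =
  if c == b then
    unit_pow f y v s a * unit_pow f y v t b * unit_pow f y v (~~ s) a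
  else unit_pow f y v t c.
Proof. by case: t; rewrite /unit_pow // swap_unit. Qed.

Lemma swap_system : quiver_system f y' v'.
Proof.
case: (S) => Bf _ _; split=> // c.
  have [->|cb] := eqVneq c b.
    by rewrite swap_gen_head -tab mulrA (sys_fg S) -mulrA (sys_yf S).
  have [->|cbs] := eqVneq c (dstar b).
    by rewrite swap_gen_dstar dstarK -tab mulrA (sys_fy S) -mulrA (sys_gf S).
  by rewrite swap_gen_other // (sys_fy S) (sys_yf S).
rewrite -/(unit_elt f y' c) swap_unit /swap_inv.
have [->|cb] := eqVneq c b; last first.
  by split; rewrite ?(sys_fv S) ?(sys_vf S) ?(sys_uv S) ?(sys_vu S).
set g1 := unit_pow _ _ _ s a; set g2 := unit_pow _ _ _ _ a.
have fg1 : f (tl b) * g1 = g1 by rewrite -tab (sys_fg S).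
have g2f : g2 * f (tl b) = g2 by rewrite -tab (sys_gf S).
have g21 : g2 * g1 = f (tl b) by rewrite -tab (sys_gNl S).
have g12 : g1 * g2 = f (tl b) by rewrite -tab (sys_gN S).
have g1f : g1 * f (tl b) = g1 by rewrite -tab (sys_gf S).
split; first by rewrite !mulrA fg1 -(mulrA _ g2 (f _)) g2f.
  rewrite -!mulrA (mulrA g2) g21 (mulrA (f _)) (sys_fv S).
  by rewrite (mulrA _ (v b)) (sys_uv S) mulrA g1f.
rewrite -!mulrA (mulrA g2) g21 (mulrA (f _)) (sys_fu S).
by rewrite (mulrA _ (unit_elt _ _ _)) (sys_vu S) mulrA g1f.
Qed.

(** Since [a] differs from [b], the unit at [a] is the same in the new system, so the move with the
    opposite exponent multiplies by its inverse. *)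
Lemma swap_genK : swap_gen f y' v' (~~ s) a b =1 y.
Proof.
move=> c; rewrite {1}/swap_gen !swap_pow (negPf nab) negbK.
rewrite swap_gen_head swap_gen_dstar.
have [->|cb] := eqVneq c b; first by rewrite mulrA (sys_gNl S) tab (sys_fy S).
have [->|cbs] := eqVneq c (dstar b); last by rewrite swap_gen_other.
by rewrite -mulrA (sys_gNl S) tab (sys_ysf S).
Qed.

End SwapSystem.

Section FlipSystem.
Variable a : dbl Ar.
Notation y' := (flip_gen y v a).
Notation v' := (flip_inv f y v a).

Lemma flip_genE d : d != a -> y' d = y d.
Proof. by rewrite /flip_gen => /negPf->. Qed.

Lemma flip_gen_a : y' a = - (v a * y a).
Proof. by rewrite /flip_gen eqxx. Qed.

Lemma flip_gen_as : y' (dstar a) = y (dstar a).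
Proof. by rewrite flip_genE // dstar_neq. Qed.

Lemma flip_unit_a : unit_elt f y' a = v a.
Proof.
have := sys_vu S a; rewrite /unit_elt flip_gen_a flip_gen_as mulrDr (sys_vf S).
by move=> <-; rewrite mulNr !mulrA addrK.
Qed.

Lemma flip_unit_as : unit_elt f y' (dstar a) = v (dstar a).
Proof.
by rewrite (sys_v_dstar S) /unit_elt dstarK flip_gen_a flip_gen_as mulrN mulrA.
Qed.

(** At [a] this is $1 - v a a^* = v$, a rearrangement of $v + v a a^* = 1$; at [dstar a] it is the
    formula for the inverse of $1 + a^* a$. *)
Lemma flip_unit c : unit_elt f y' c =
  if (c == a) || (c == dstar a) then v c else unit_elt f y c.
Proof.
have [->|ca] := eqVneq c a; first exact: flip_unit_a.
have [->|cas] /= := eqVneq c (dstar a); first exact: flip_unit_as.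
by rewrite /unit_elt !flip_genE // eq_dstarl.
Qed.

Lemma flip_pow t c : unit_pow f y' v' t c =
  unit_pow f y v (t (+) ((c == a) || (c == dstar a))) c.
Proof. by rewrite /unit_pow flip_unit /flip_inv; case: t; case: (_ || _). Qed.

Lemma flip_system : quiver_system f y' v'.
Proof.
case: (S) => Bf _ _; split=> // c.
  have [->|ca] := eqVneq c a.
    by rewrite flip_gen_a mulrN mulNr mulrA (sys_fv S) -mulrA (sys_yf S).
  by rewrite flip_genE // (sys_fy S) (sys_yf S).
rewrite -/(unit_elt f y' c) flip_unit /flip_inv; case: ifP => _.
  by split; rewrite ?(sys_fu S) ?(sys_uf S) ?(sys_uv S) ?(sys_vu S).
by split; rewrite ?(sys_fv S) ?(sys_vf S) ?(sys_uv S) ?(sys_vu S).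
Qed.

(** The move is an involution: the new inverse at [a] is the old unit, and the two signs cancel. *)
Lemma flip_genK : flip_gen y' v' a =1 y.
Proof.
move=> c; rewrite {1}/flip_gen.
have [->|ca] := eqVneq c a; last by rewrite flip_genE.
by rewrite flip_gen_a /flip_inv eqxx mulrN opprK mulrA (sys_uv S) (sys_fy S).
Qed.

End FlipSystem.
End Moves.

Arguments swap_gen_other {R f y v a b s c}.
Arguments flip_genE {R y v a d}.

(** * Bilinear test maps on the tensor square *)

Section Tensor.
Variables (A : algType K) (W : lmodType K).
Implicit Types (f : A -> A -> W).

(** Tensors are known only through bilinear maps, so the flip and the outer and inner bimodule
    actions on the tensor square are transferred to the test map [f]. *)
Definition tswap f := fun p q => f q p.
Definition touterl z f := fun p q => f (z * p) q.
Definition tinnerr z f := fun p q => f (p * z) q.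
Definition tinnerl z f := fun p q => f p (z * q).
Definition touterr z f := fun p q => f p (q * z).

Lemma bilin_swap f : bilin f -> bilin (tswap f).
Proof. by case=> H1 H2; split=> *; rewrite /tswap ?H1 ?H2. Qed.

Lemma bilin_outerl z f : bilin f -> bilin (touterl z f).
Proof.
by case=> H1 H2; split=> *; rewrite /touterl ?mulrDr -?scalerAr ?H1 ?H2.
Qed.

Lemma bilin_innerr z f : bilin f -> bilin (tinnerr z f).
Proof.
by case=> H1 H2; split=> *; rewrite /tinnerr ?mulrDl -?scalerAl ?H1 ?H2.
Qed.

Lemma bilin_innerl z f : bilin f -> bilin (tinnerl z f).
Proof.
by case=> H1 H2; split=> *; rewrite /tinnerl ?mulrDr -?scalerAr ?H1 ?H2.
Qed.

Lemma bilin_outerr z f : bilin f -> bilin (touterr z f).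
Proof.
by case=> H1 H2; split=> *; rewrite /touterr ?mulrDl -?scalerAl ?H1 ?H2.
Qed.

Section Bilin.
Variables (f : A -> A -> W) (Hf : bilin f).

Lemma bilinDl p p' q : f (p + p') q = f p q + f p' q.
Proof. by case: Hf => H _; have := H 1 p p' q; rewrite !scale1r. Qed.

Lemma bilinDr p q q' : f p (q + q') = f p q + f p q'.
Proof. by case: Hf => _ H; have := H 1 p q q'; rewrite !scale1r. Qed.

Lemma bilin0l q : f 0 q = 0.
Proof. by apply: (addrI (f 0 q)); rewrite -bilinDl !addr0. Qed.

Lemma bilin0r p : f p 0 = 0.
Proof. by apply: (addrI (f p 0)); rewrite -bilinDr !addr0. Qed.

Lemma bilinZl k p q : f (k *: p) q = k *: f p q.
Proof. by case: Hf => H _; have := H k p 0 q; rewrite bilin0l !addr0. Qed.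

Lemma bilinZr k p q : f p (k *: q) = k *: f p q.
Proof. by case: Hf => _ H; have := H k p q 0; rewrite bilin0r !addr0. Qed.

Lemma bilinNl p q : f (- p) q = - f p q.
Proof. by rewrite -[- p]scaleN1r bilinZl scaleN1r. Qed.

Lemma bilinNr p q : f p (- q) = - f p q.
Proof. by rewrite -[- q]scaleN1r bilinZr scaleN1r. Qed.

End Bilin.
End Tensor.

Hint Resolve bilin_swap bilin_outerl bilin_innerr bilin_innerl bilin_outerr
  : bilin.

(* Twice the value on [f] of the double bracket of [a] and [b]; the factor 2
   clears the denominators of the quiver formulas. *)
Definition dbr (A : algType K) (br : A -> A -> seq (A * A)) (W : lmodType K)
    (f : A -> A -> W) (a b : A) : W :=
  2 *: \sum_(p <- br a b) f p.1 p.2.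

(** * Leibniz rules for double brackets, on test maps *)

Section DoubleBracket.
Variables (A : algType K) (e : I -> A) (br : A -> A -> seq (A * A)).
Hypothesis DB : double_bracket e br.
Variables (W : lmodType K).
Implicit Types (f : A -> A -> W).

Lemma dbr_linl f : bilin f -> forall k a a' b,
  dbr br f (k *: a + a') b = k *: dbr br f a b + dbr br f a' b.
Proof.
move=> Hf k a a' b; case: DB => H _ _ _ _; rewrite /dbr (H _ _ _ _ _ _ Hf).
rewrite big_cat big_map /= scalerDr scalerA mulrC -scalerA; congr (_ *: _ + _).
by rewrite scaler_sumr; apply: eq_bigr => p _; rewrite bilinZl.
Qed.

Lemma dbr_linr f : bilin f -> forall k a b b',
  dbr br f a (k *: b + b') = k *: dbr br f a b + dbr br f a b'.
Proof.
move=> Hf k a b b'; case: DB => _ H _ _ _; rewrite /dbr (H _ _ _ _ _ _ Hf).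
rewrite big_cat big_map /= scalerDr scalerA mulrC -scalerA; congr (_ *: _ + _).
by rewrite scaler_sumr; apply: eq_bigr => p _; rewrite bilinZl.
Qed.

Lemma dbr_anti f : bilin f -> forall a b,
  dbr br f a b = - dbr br (tswap f) b a.
Proof.
move=> Hf a b; case: DB => _ _ H _ _; rewrite /dbr (H _ _ _ _ Hf).
rewrite !big_map -scalerN -sumrN; congr (_ *: _).
by apply: eq_bigr => p _; rewrite /= bilinZl // scaleN1r.
Qed.

Lemma dbr_Mr f : bilin f -> forall a b c,
  dbr br f a (b * c) = dbr br (touterr c f) a b + dbr br (touterl b f) a c.
Proof.
move=> Hf a b c; case: DB => _ _ _ H _; rewrite /dbr (H _ _ _ _ _ Hf).
by rewrite big_cat !big_map /= scalerDr.
Qed.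

(** By antisymmetry, the outer derivation rule in the second argument becomes a derivation rule for
    the inner bimodule structure in the first. *)
Lemma dbr_Ml f : bilin f -> forall a b c,
  dbr br f (a * b) c = dbr br (tinnerr b f) a c + dbr br (tinnerl a f) b c.
Proof.
move=> Hf a b c; rewrite dbr_anti // dbr_Mr; last exact: bilin_swap.
rewrite opprD [in RHS]dbr_anti; last exact: bilin_innerr.
by rewrite [X in _ = _ + X]dbr_anti //; exact: bilin_innerl.
Qed.

Lemma dbr_el f : bilin f -> forall s a, dbr br f (e s) a = 0.
Proof.
move=> Hf s a; case: DB => _ _ _ _ /(_ (fun s' => (s' == s)%:R) a)[H _].
have E : \sum_s' (s' == s)%:R *: e s' = e s.
  rewrite (bigD1 s) //= eqxx scale1r big1 ?addr0 // => s' /negPf->.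
  by rewrite scale0r.
move: H; rewrite E => /(_ _ _ Hf); rewrite big_nil /dbr => ->.
by rewrite scaler0.
Qed.

Lemma dbr_er f : bilin f -> forall s a, dbr br f a (e s) = 0.
Proof.
by move=> Hf s a; rewrite dbr_anti // dbr_el ?oppr0 //; exact: bilin_swap.
Qed.

Lemma dbr_Dl f : bilin f -> forall a a' b,
  dbr br f (a + a') b = dbr br f a b + dbr br f a' b.
Proof. by move=> Hf a a' b; have := dbr_linl Hf 1 a a' b; rewrite !scale1r. Qed.

Lemma dbr_Dr f : bilin f -> forall a b b',
  dbr br f a (b + b') = dbr br f a b + dbr br f a b'.
Proof. by move=> Hf a b b'; have := dbr_linr Hf 1 a b b'; rewrite !scale1r. Qed.

Lemma dbr_Nl f : bilin f -> forall a b, dbr br f (- a) b = - dbr br f a b.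
Proof.
move=> Hf a b; apply: (addrI (dbr br f a b)); rewrite -dbr_Dl // !subrr.
by apply: (addrI (dbr br f 0 b)); rewrite -dbr_Dl // !addr0.
Qed.

Lemma dbr_Nr f : bilin f -> forall a b, dbr br f a (- b) = - dbr br f a b.
Proof.
by move=> Hf a b; rewrite dbr_anti // dbr_Nl -?dbr_anti //; exact: bilin_swap.
Qed.

(** The rule $\{a, b^{-1}\} = -b^{-1}\{a, b\}b^{-1}$ in a corner: expand $\{a, bc\} = \{a, e_s\} =
    0$ and multiply by $c$ on the left. *)
Lemma dbr_invr f s a b c : bilin f -> b * c = e s -> c * b = e s ->
  e s * c = c ->
  dbr br f a c = - dbr br (touterl c (touterr c f)) a b.
Proof.
move=> Hf bc cb ec.
have Hf' := bilin_outerl c Hf.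
have := dbr_Mr Hf' a b c; rewrite bc dbr_er //.
have -> : dbr br (touterl b (touterl c f)) a c = dbr br f a c.
  rewrite -[in RHS]ec (dbr_Mr Hf) dbr_er ?add0r //; last exact: bilin_outerr.
  rewrite /dbr; congr (_ *: _); apply: eq_bigr => p _.
  by rewrite /touterl mulrA cb.
by move/esym/eqP; rewrite addrC addr_eq0 => /eqP->.
Qed.

Lemma dbr_invl f s a b c : bilin f -> b * c = e s -> c * b = e s ->
  e s * c = c ->
  dbr br f c a = - dbr br (tinnerr c (tinnerl c f)) b a.
Proof.
move=> Hf bc cb ec; rewrite dbr_anti //.
rewrite (dbr_invr _ (bilin_swap Hf) bc cb) // opprK dbr_anti //; last first.
  by do 2?[apply: bilin_outerl | apply: bilin_outerr]; apply: bilin_swap.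
Qed.

End DoubleBracket.

(* The three cases of the bracket on generators in one formula: the terms in [o]
   also give {{a,a}}, and the last line is what {{a,a*}} has in addition. *)
Definition quiver_form (A : algType K) (e : I -> A) (x : dbl Ar -> A)
    (eps : dbl Ar -> bool) (o : dbl Ar -> dbl Ar -> K)
    (W : lmodType K) (f : A -> A -> W) (b c : dbl Ar) : W :=
  - (o b c *: f (x b) (x c)) - o (dstar b) (dstar c) *: f (x c) (x b)
  + o b (dstar c) *: f (x c * x b) (e (tl b))
  + o (dstar b) c *: f (e (tl (dstar b))) (x b * x c)
  + ((c == dstar b)%:R * (-1) ^+ eps b) *:
      (f (unit_elt e x (dstar b)) (e (tl b))
       + f (e (tl (dstar b))) (unit_elt e x b)).

Definition is_quiver_bracket (A : algType K) (e : I -> A) (x : dbl Ar -> A)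
    (eps : dbl Ar -> bool) (o : dbl Ar -> dbl Ar -> K)
    (br : A -> A -> seq (A * A)) :=
  forall (W : lmodType K) (f : A -> A -> W), bilin f ->
    forall b c, dbr br f (x b) (x c) = quiver_form e x eps o f b c.

(** The general properties of the order signs used in the computations: [o b c] stands for the sign
    at the common tail of [b] and [c], and is zero if the tails differ. *)
Definition vertex_sign (o : dbl Ar -> dbl Ar -> K) :=
  [/\ forall b, o b b = 0, forall b c, o c b = - o b c &
      forall b c, o b c = 0 \/ tl b = tl c].

(** Exchanging [b] and [c] swaps the two terms containing products, and the last line changes sign
    because [eps] separates an arrow from its star. This halves the cases to check for new
    generators. *)
Lemma quiver_form_anti (A : algType K) (e : I -> A) (x : dbl Ar -> A)
    (eps : dbl Ar -> bool) (o : dbl Ar -> dbl Ar -> K)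
    (W : lmodType K) (f : A -> A -> W) (b c : dbl Ar) :
  (forall c, eps (dstar c) = ~~ eps c) -> vertex_sign o ->
  quiver_form e x eps o f b c = - quiver_form e x eps o (tswap f) c b.
Proof.
move=> epsN [oxx oN ot]; rewrite /quiver_form /tswap (oN b c).
rewrite (oN (dstar b) (dstar c)) (oN b (dstar c)) (oN (dstar b) c).
(* When the sign is nonzero the two tails agree, so the idempotents do too. *)
have -> : o b (dstar c) *: f (x c * x b) (e (tl b)) =
          o b (dstar c) *: f (x c * x b) (e (tl (dstar c))).
  by case: (ot b (dstar c)) => ->; rewrite ?scale0r.
have -> : o (dstar b) c *: f (e (tl (dstar b))) (x b * x c) =
          o (dstar b) c *: f (e (tl c)) (x b * x c).
  by case: (ot (dstar b) c) => ->; rewrite ?scale0r.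
rewrite [b == _]eq_sym eq_dstarl.
have [->|_] := eqVneq c (dstar b); last by lmod_ring.
by rewrite epsN signrN dstarK; lmod_ring.
Qed.

(** * Brackets with the factors of the moment map *)

Section Moment.
Variables (A : algType K) (e : I -> A) (x w : dbl Ar -> A).
Variables (br : A -> A -> seq (A * A)).
Variables (eps : dbl Ar -> bool) (o : dbl Ar -> dbl Ar -> K).
Hypothesis S : quiver_system e x w.
Hypothesis DB : double_bracket e br.
Hypothesis epsN : forall c, eps (dstar c) = ~~ eps c.
Hypothesis Ho : vertex_sign o.
Hypothesis HB : is_quiver_bracket e x eps o br.
Variable W : lmodType K.
Implicit Types (f : A -> A -> W).
Notation u := (unit_elt e x).
Notation g := (unit_pow e x w).

Lemma sys_ux c : u c * x c = x c * u (dstar c).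
Proof.
by rewrite /unit_elt dstarK mulrDl mulrDr (sys_fy S) (sys_yf S) mulrA.
Qed.

(** When the sign is nonzero, [a] and [c] share their tail, and the idempotent summand of [u a]
    contributes the same term twice with opposite signs. *)
Lemma sign_unitl f a c : bilin f ->
  o a c *: (f (e (tl a)) (u a * x c) - f (u a) (x c)) =
  o a c *: (f (e (tl a)) (x a * x (dstar a) * x c)
            - f (x a * x (dstar a)) (x c)).
Proof.
move=> Hf; case: Ho => _ _ /(_ a c)[->|E]; first by rewrite !scale0r.
rewrite /unit_elt mulrDl E (sys_fy S) (bilinDl Hf) (bilinDr Hf).
by rewrite opprD addrACA subrr add0r.
Qed.

Lemma sign_unitr f a c : bilin f ->
  o a (dstar c) *: (f (x c * u a) (e (tl a)) - f (x c) (u a)) =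
  o a (dstar c) *: (f (x c * x a * x (dstar a)) (e (tl a))
                    - f (x c) (x a * x (dstar a))).
Proof.
move=> Hf; case: Ho => _ _ /(_ a (dstar c))[->|E]; first by rewrite !scale0r.
rewrite /unit_elt mulrDr E (sys_yf S) (bilinDl Hf) (bilinDr Hf) mulrA.
by rewrite opprD addrACA subrr add0r.
Qed.

(** The moment map formula localised at [a]. Expanding $aa^*$ by the Leibniz rule, the signs of
    [dstar a] occur twice and cancel; those of [a] remain, together with the pairing terms for
    [c = a] and [c = dstar a]. *)
Lemma dbr_unit_elt f : bilin f -> forall a c,
  dbr br f (u a) (x c) =
    o a c *: (f (e (tl a)) (u a * x c) - f (u a) (x c))
  + o a (dstar c) *: (f (x c * u a) (e (tl a)) - f (x c) (u a))
  + (-1) ^+ eps a *: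
     ((dstar c == a)%:R *: (f (x c * u a) (e (tl a)) + f (x c) (u a))
      - (c == a)%:R *: (f (u a) (x c) + f (e (tl a)) (u a * x c))).
Proof.
move=> Hf a c.
rewrite sign_unitl // sign_unitr //.
rewrite [in LHS]/unit_elt (dbr_Dl DB) // (dbr_el DB) // add0r (dbr_Ml DB) //.
rewrite !HB; auto with bilin.
rewrite /quiver_form /tinnerr /tinnerl dstarK epsN signrN -eq_dstarl.
have [->|nca] := eqVneq c a; last have [<-|nca'] := eqVneq (dstar c) a.
- rewrite dstar_neq (sys_fy S) (sys_yf S) -sys_ux !mulrA; lmod_ring.
- rewrite sys_ux dstarK (sys_fy S) !mulrA (sys_ysf S).
  lmod_ring.
- rewrite (sys_fy S) (sys_yf S) !mulrA; lmod_ring.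
Qed.

Lemma sign_absorbl f a c p : o a c *: f p (e (tl a) * x c) = o a c *: f p (x c).
Proof. by case: Ho => _ _ /(_ a c)[->|->]; rewrite ?scale0r ?(sys_fy S). Qed.

Lemma sign_absorbr f a c q :
  o a (dstar c) *: f (x c * e (tl a)) q = o a (dstar c) *: f (x c) q.
Proof.
by case: Ho => _ _ /(_ a (dstar c))[->|->]; rewrite ?scale0r ?(sys_yf S).
Qed.

Lemma delta_absorbl f a c p :
  (c == a)%:R *: f p (e (tl a) * x c) = (c == a)%:R *: f p (x c).
Proof. by case: eqP => [->|]; rewrite ?scale0r ?(sys_fy S). Qed.

Lemma delta_absorbr f a c q :
  (dstar c == a)%:R *: f (x c * e (tl a)) q = (dstar c == a)%:R *: f (x c) q.
Proof. by case: eqP => [<-|]; rewrite ?scale0r ?(sys_yf S). Qed.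

(** Passing to the inverse exchanges the two terms of each bracketed pair and adds a minus sign. The
    differences, weighted by [o], are thus preserved, and the sums, weighted by the pairing, change
    sign. *)
Lemma dbr_unit_pow f s : bilin f -> forall a c,
  dbr br f (g s a) (x c) =
    o a c *: (f (e (tl a)) (g s a * x c) - f (g s a) (x c))
  + o a (dstar c) *: (f (x c * g s a) (e (tl a)) - f (x c) (g s a))
  + (-1) ^+ (s (+) eps a) *:
     ((dstar c == a)%:R *: (f (x c * g s a) (e (tl a)) + f (x c) (g s a))
      - (c == a)%:R *: (f (g s a) (x c) + f (e (tl a)) (g s a * x c))).
Proof.
move=> Hf a c; case: s; last exact: dbr_unit_elt.
rewrite (dbr_invl DB _ Hf (sys_uv S a) (sys_vu S a) (sys_fv S a)).
rewrite dbr_unit_elt; auto with bilin.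
rewrite /unit_pow /tinnerr /tinnerl !mulrA (sys_vu S) -!(mulrA (x c)).
rewrite (sys_uv S) (sys_fv S) (sys_vf S) signrN.
rewrite !scalerDr !scalerN sign_absorbl sign_absorbr.
rewrite delta_absorbl delta_absorbr.
lmod_ring.
Qed.

(** The order terms coming from [x a] and from [x (dstar a)] cancel, so the bracket between powers
    of one unit is independent of the order. *)
Lemma dbr_unit_pow_elt f s : bilin f -> forall a,
  dbr br f (g s a) (u a) = (-1) ^+ (s (+) eps a) *:
   (f (u a * g s a) (e (tl a)) + f (u a) (g s a)
    - f (g s a) (u a) - f (e (tl a)) (g s a * u a)).
Proof.
move=> Hf a.
rewrite {1}/unit_elt (dbr_Dr DB) // (dbr_er DB) // add0r (dbr_Mr DB) //.
rewrite !dbr_unit_pow; auto with bilin.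
rewrite dstarK dstar_neq eqxx /touterl /touterr [in RHS]/unit_elt.
rewrite mulrDl mulrDr (sys_fg S) (sys_gf S) !(bilinDl Hf) !(bilinDr Hf) !mulrA.
rewrite !scalerDr !scalerN sign_absorbl sign_absorbr.
by case: Ho => -> _ _; lmod_ring.
Qed.

(** For the exponent occurring in the moment map the orientation sign is $+1$, and the pairing only
    shifts the order signs by one. *)
Lemma dbr_phi f : bilin f -> forall a c,
  dbr br f (g (eps a) a) (x c) =
    (o a c - (c == a)%:R) *: f (e (tl a)) (g (eps a) a * x c)
  - (o a c + (c == a)%:R) *: f (g (eps a) a) (x c)
  + (o a (dstar c) + (dstar c == a)%:R) *: f (x c * g (eps a) a) (e (tl a))
  - (o a (dstar c) - (dstar c == a)%:R) *: f (x c) (g (eps a) a).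
Proof. by move=> Hf a c; rewrite dbr_unit_pow // addbb; lmod_ring. Qed.

Lemma dbr_phiV f : bilin f -> forall a c,
  dbr br f (g (~~ eps a) a) (x c) =
    (o a c + (c == a)%:R) *: f (e (tl a)) (g (~~ eps a) a * x c)
  - (o a c - (c == a)%:R) *: f (g (~~ eps a) a) (x c)
  + (o a (dstar c) - (dstar c == a)%:R) *: f (x c * g (~~ eps a) a) (e (tl a))
  - (o a (dstar c) + (dstar c == a)%:R) *: f (x c) (g (~~ eps a) a).
Proof. by move=> Hf a c; rewrite dbr_unit_pow // addNb addbb; lmod_ring. Qed.

Lemma dbr_unit_pow_inv f s : bilin f -> forall a,
  dbr br f (g s a) (w a) = (-1) ^+ (s (+) eps a) *:
   (f (w a * g s a) (e (tl a)) + f (w a) (g s a)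
    - f (g s a) (w a) - f (e (tl a)) (g s a * w a)).
Proof.
move=> Hf a.
rewrite (dbr_invr DB _ Hf (sys_uv S a) (sys_vu S a) (sys_fv S a)).
rewrite dbr_unit_pow_elt; auto with bilin.
rewrite /touterl /touterr !mulrA (sys_vu S) -!(mulrA (g s a)) (sys_uv S).
rewrite (sys_fv S) (sys_vf S) (sys_gf S) (sys_fg S); lmod_ring.
Qed.

Lemma dbr_unit_pow2 f s t : bilin f -> forall a,
  dbr br f (g s a) (g t a) = (-1) ^+ (s (+) eps a) *:
   (f (g t a * g s a) (e (tl a)) + f (g t a) (g s a)
    - f (g s a) (g t a) - f (e (tl a)) (g s a * g t a)).
Proof.
by move=> Hf a; case: t; [exact: dbr_unit_pow_inv | exact: dbr_unit_pow_elt].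
Qed.

(** * Exchange of two consecutive half-edges *)

Section Swap.
Variables (a b : dbl Ar) (o' : dbl Ar -> dbl Ar -> K).
Hypothesis tab : tl a = tl b.
Hypothesis nab : a != b.
Hypothesis oab : o a b = 1.
Hypothesis adj : forall d, d != a -> d != b -> o a d = o b d.
Hypothesis Ho' : vertex_sign o'.
Hypothesis oba' : o' b a = 1.
Hypothesis oE' : forall c d,
  ~~ ((c == a) && (d == b)) -> ~~ ((c == b) && (d == a)) -> o' c d = o c d.
Notation phi := (g (eps a) a).
Notation phiV := (g (~~ eps a) a).
Notation x' := (swap_gen e x w (eps a) a b).

(** Adjacency makes the signs of [a] and [b] against a third half-edge equal. The correction at
    [d = a] is $-1$ before the exchange and, in the next lemma, $+1$ after it. *)
Lemma swap_sign_b d : d != b -> o b d = o a d - (d == a)%:R.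
Proof.
case: Ho => oxx oN _ db; have [->|da] := eqVneq d a; last by rewrite subr0 adj.
by rewrite oN oab oxx sub0r.
Qed.

Lemma swap_sign'_b d : d != b -> o' b d = o a d + (d == a)%:R.
Proof.
case: Ho => oxx oN _ db.
have [->|da] := eqVneq d a; first by rewrite oba' oxx add0r.
by rewrite addr0 oE' ?adj // ?(negPf db) ?(negPf da) ?andbF.
Qed.

Lemma swap_sign' c d : c != b -> d != b -> o' c d = o c d.
Proof. by move=> /negPf cb /negPf db; rewrite oE' ?cb ?db ?andbF. Qed.

Lemma swap_eb : e (tl a) * x b = x b.
Proof. by rewrite tab (sys_fy S). Qed.

Lemma swap_bse : x (dstar b) * e (tl a) = x (dstar b).
Proof. by rewrite tab (sys_ysf S). Qed.

Lemma swap_dsb : dstar b != b.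
Proof. by rewrite dstar_neq. Qed.

(** The term $b \otimes \phi d$ gets the coefficient $(o(a,d) - \delta) - o(b,d) = 0$, and $\phi b
    \otimes d$ gets $-(o(a,d) + \delta) = -o'(b,d)$. The same shift occurs for [dstar d]. *)
Lemma swap_b_other f d : bilin f -> d != b -> d != dstar b ->
  dbr br f (phi * x b) (x d) = quiver_form e x' eps o' f b d.
Proof.
move=> Hf db dbs; have sdb : dstar d != b by rewrite eq_dstarl.
rewrite (dbr_Ml DB) // dbr_phi ?HB; auto with bilin.
rewrite /quiver_form swap_gen_head swap_gen_other // (negPf dbs).
rewrite !swap_sign'_b // !swap_sign' ?swap_dsb //.
rewrite !(swap_sign_b db) (swap_sign_b sdb).
rewrite /tinnerr /tinnerl -!tab !mulrA swap_eb (sys_gf S).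
lmod_ring.
Qed.

Lemma swap_bs_other f d : bilin f -> d != b -> d != dstar b ->
  dbr br f (x (dstar b) * phiV) (x d) = quiver_form e x' eps o' f (dstar b) d.
Proof.
move=> Hf db dbs; have sdb : dstar d != b by rewrite eq_dstarl.
rewrite (dbr_Ml DB) // dbr_phiV ?HB; auto with bilin.
rewrite /quiver_form dstarK swap_gen_dstar swap_gen_other // (negPf db).
rewrite !swap_sign'_b // !swap_sign' ?swap_dsb //.
rewrite !(swap_sign_b db) (swap_sign_b sdb).
rewrite /tinnerr /tinnerl -!tab !mulrA swap_bse (sys_fg S); lmod_ring.
Qed.

Lemma phi_phiV : phi * phiV = e (tl a). Proof. exact: sys_gN. Qed.
Lemma phiV_phi : phiV * phi = e (tl a). Proof. exact: sys_gNl. Qed.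

(** Products are kept associated to the left, so a rule for [p * q] must also be stated behind a
    prefix [z]. *)
Lemma mul_rulel (p q r : A) : p * q = r -> forall z, z * p * q = z * r.
Proof. by move=> <- z; rewrite mulrA. Qed.

Definition swap_simp := (phi_phiV, phiV_phi, swap_eb, swap_bse,
  sys_fg S, sys_gf S, sys_ff S, mul_rulel phi_phiV, mul_rulel phiV_phi,
  mul_rulel swap_eb, mul_rulel swap_bse,
  mul_rulel (sys_fg S (eps a) a), mul_rulel (sys_gf S (eps a) a),
  mul_rulel (sys_fg S (~~ eps a) a), mul_rulel (sys_gf S (~~ eps a) a)).

(** Either [b] is a loop, and the idempotent at its other end is absorbed by [phi], or every sign
    and pairing between [a] and [dstar b] vanishes. *)
Lemma swap_tail : tl (dstar b) = tl a \/
  o a (dstar b) = 0 /\ (dstar b == a) = false.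
Proof.
have [E|N] := eqVneq (tl (dstar b)) (tl a); [by left | right; split].
  by case: Ho => _ _ /(_ a (dstar b))[] // E; rewrite E eqxx in N.
by apply: contraNF N => /eqP->.
Qed.

Lemma swap_bb f : bilin f ->
  dbr br f (phi * x b) (phi * x b) = quiver_form e x' eps o' f b b.
Proof.
move=> Hf; case: (Ho) => oxx oN _; case: (Ho') => oxx' oN' _.
rewrite (dbr_Ml DB) // !(dbr_Mr DB); auto with bilin.
(* The bracket of [x b] with [phi] is flipped, so that [phi] always stands on the left. *)
rewrite [X in _ + (X + _)](dbr_anti DB); auto 6 with bilin.
rewrite !dbr_phi ?dbr_unit_pow2 ?HB; auto 7 with bilin.
rewrite /quiver_form swap_gen_head [b == dstar b]eq_sym (negPf swap_dsb).
rewrite [b == a]eq_sym (negPf nab) addbb.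
rewrite !oxx !oxx' (oN b (dstar b)) (oN' b (dstar b)) oab.
rewrite swap_sign'_b ?swap_dsb // swap_sign_b ?swap_dsb //.
rewrite /tinnerr /tinnerl /touterr /touterl /tswap -!tab !mulrA !swap_simp.
case: swap_tail => [->|[-> ->]]; last by lmod_ring.
by rewrite !swap_simp; lmod_ring.
Qed.

Lemma swap_bsbs f : bilin f ->
  dbr br f (x (dstar b) * phiV) (x (dstar b) * phiV) =
  quiver_form e x' eps o' f (dstar b) (dstar b).
Proof.
move=> Hf; case: (Ho) => oxx oN _; case: (Ho') => oxx' oN' _.
rewrite (dbr_Ml DB) // !(dbr_Mr DB); auto with bilin.
rewrite [X in _ + X + _](dbr_anti DB); auto 6 with bilin.
rewrite !dbr_phiV ?dbr_unit_pow2 ?HB; auto 7 with bilin.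
rewrite /quiver_form dstarK swap_gen_dstar (negPf swap_dsb) [b == a]eq_sym.
rewrite (negPf nab) addNb addbb.
rewrite !oxx !oxx' (oN b (dstar b)) (oN' b (dstar b)) oab.
rewrite swap_sign'_b ?swap_dsb // swap_sign_b ?swap_dsb //.
rewrite /tinnerr /tinnerl /touterr /touterl /tswap -!tab !mulrA !swap_simp.
case: swap_tail => [->|[-> ->]]; last by lmod_ring.
by rewrite ?swap_simp; lmod_ring.
Qed.

Lemma swap_unit_head : unit_elt e x' b = phi * u b * phiV.
Proof. by rewrite (swap_unit S) // eqxx. Qed.

Lemma swap_unit_dstar : unit_elt e x' (dstar b) = u (dstar b).
Proof. by rewrite (swap_unit S) // (negPf swap_dsb). Qed.

Lemma swap_bbs f : bilin f ->
  dbr br f (phi * x b) (x (dstar b) * phiV) =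
  quiver_form e x' eps o' f b (dstar b).
Proof.
move=> Hf; case: (Ho) => oxx oN _; case: (Ho') => oxx' oN' _.
rewrite (dbr_Ml DB) // !(dbr_Mr DB); auto with bilin.
rewrite [X in _ + (_ + X)](dbr_anti DB); auto 6 with bilin.
rewrite !dbr_phi ?dbr_phiV ?dbr_unit_pow2 ?HB; auto 7 with bilin.
rewrite /quiver_form swap_unit_head swap_unit_dstar dstarK swap_gen_head.
rewrite swap_gen_dstar eqxx [b == a]eq_sym (negPf nab) addbb.
rewrite !oxx !oxx' (oN b (dstar b)) (oN' b (dstar b)) oab.
rewrite swap_sign'_b ?swap_dsb // swap_sign_b ?swap_dsb //.
rewrite /tinnerr /tinnerl /touterr /touterl /tswap -!tab !mulrA !swap_simp.
lmod_ring.
Qed.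

Lemma swap_bracket f : bilin f -> forall c d,
  dbr br f (x' c) (x' d) = quiver_form e x' eps o' f c d.
Proof.
move=> Hf c d.
(* Antisymmetry of both sides reduces the nine positions of [c] and [d] relative to [b] and
   [dstar b] to six. *)
have anti c1 d1 : dbr br (tswap f) (x' d1) (x' c1) =
    quiver_form e x' eps o' (tswap f) d1 c1 ->
    dbr br f (x' c1) (x' d1) = quiver_form e x' eps o' f c1 d1.
  by move=> E; rewrite (dbr_anti DB) // E [RHS]quiver_form_anti.
have Hs := bilin_swap Hf.
have [->|cb] := eqVneq c b; last have [->|cbs] := eqVneq c (dstar b).
- have [->|db] := eqVneq d b; last have [->|dbs] := eqVneq d (dstar b).
  + by rewrite swap_gen_head swap_bb.
  + by rewrite swap_gen_head swap_gen_dstar swap_bbs.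
  + by rewrite swap_gen_head (swap_gen_other db dbs) swap_b_other.
- have [->|db] := eqVneq d b; last have [->|dbs] := eqVneq d (dstar b).
  + by apply: anti; rewrite swap_gen_head swap_gen_dstar swap_bbs.
  + by rewrite swap_gen_dstar swap_bsbs.
  + by rewrite swap_gen_dstar (swap_gen_other db dbs) swap_bs_other.
have [->|db] := eqVneq d b; last have [->|dbs] := eqVneq d (dstar b).
- by apply: anti; rewrite swap_gen_head (swap_gen_other cb cbs) swap_b_other.
- by apply: anti; rewrite swap_gen_dstar (swap_gen_other cb cbs) swap_bs_other.
have scb : dstar c != b by rewrite eq_dstarl.
have sdb : dstar d != b by rewrite eq_dstarl.
have scbs : dstar c != dstar b by rewrite eq_dstar.
rewrite (swap_gen_other cb cbs) (swap_gen_other db dbs) HB //.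
by rewrite /quiver_form /unit_elt !swap_gen_other ?dstarK // !swap_sign'.
Qed.

End Swap.

(** * Reversal of an arrow *)

Section Flip.
Variable a : dbl Ar.
Hypothesis epsa : eps a = false.
Notation x' := (flip_gen x w a).
Notation eps' := (fun c => eps c (+) ((c == a) || (c == dstar a))).

Lemma dbr_w f c : bilin f -> dbr br f (w a) (x c) =
    (o a c + (c == a)%:R) *: f (e (tl a)) (w a * x c)
  - (o a c - (c == a)%:R) *: f (w a) (x c)
  + (o a (dstar c) - (dstar c == a)%:R) *: f (x c * w a) (e (tl a))
  - (o a (dstar c) + (dstar c == a)%:R) *: f (x c) (w a).
Proof. by move=> Hf; have := dbr_phiV Hf a c; rewrite epsa. Qed.

Lemma dbr_ww f : bilin f -> dbr br f (w a) (w a) =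
  f (e (tl a)) (w a * w a) - f (w a * w a) (e (tl a)).
Proof.
move=> Hf; have := dbr_unit_pow2 true true Hf a; rewrite epsa => ->.
by lmod_ring.
Qed.

Lemma flip_a_other f d : bilin f -> d != a -> d != dstar a ->
  dbr br f (- (w a * x a)) (x d) = quiver_form e x' eps' o f a d.
Proof.
move=> Hf da das.
rewrite (dbr_Nl DB) // (dbr_Ml DB) // dbr_w ?HB; auto with bilin.
rewrite /quiver_form flip_gen_a flip_genE // eq_dstarl (negPf da) (negPf das).
rewrite /tinnerr /tinnerl mulNr mulrN !(bilinNl Hf) !(bilinNr Hf).
by rewrite !mulrA (sys_fy S) (sys_vf S); lmod_ring.
Qed.

Lemma flip_aas f : bilin f ->
  dbr br f (- (w a * x a)) (x (dstar a)) =
  quiver_form e x' eps' o f a (dstar a).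
Proof.
move=> Hf; case: (Ho) => oxx oN _.
rewrite (dbr_Nl DB) // (dbr_Ml DB) // dbr_w ?HB; auto with bilin.
rewrite /quiver_form (flip_unit_a S) (flip_unit_as S) flip_gen_a flip_gen_as.
rewrite !eqxx dstarK dstar_neq eqxx orTb epsa !oxx (oN a (dstar a)).
(* Both sides are now expressed by [w a], [x a] and [x (dstar a)] alone. *)
rewrite (sys_v_dstar S).
rewrite /tinnerr /tinnerl [in LHS]/unit_elt dstarK !mulrDr mulNr mulrN.
rewrite -[- (x (dstar a) * w a * x a)]mulNr.
rewrite !(bilinDl Hf) !(bilinDr Hf) !(mulNr, bilinNl Hf, bilinNr Hf).
rewrite !mulrA (sys_fy S) (sys_vf S).
have E : w a * x a * x (dstar a) = e (tl a) - w a.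
  by rewrite -(sys_vu S a) mulrDr (sys_vf S) addrC addKr mulrA.
rewrite E !(bilinDr Hf) !(bilinNr Hf).
by lmod_ring.
Qed.

Lemma flip_aa f : bilin f ->
  dbr br f (- (w a * x a)) (- (w a * x a)) = quiver_form e x' eps' o f a a.
Proof.
move=> Hf; case: (Ho) => oxx oN ot.
rewrite (dbr_Nl DB) // (dbr_Nr DB) // opprK (dbr_Ml DB) //.
rewrite !(dbr_Mr DB); auto with bilin.
rewrite [X in _ + (X + _)](dbr_anti DB); auto 6 with bilin.
rewrite !dbr_w ?dbr_ww ?HB; auto 7 with bilin.
rewrite /quiver_form flip_gen_a dstar_neq [a == dstar a]eq_sym dstar_neq.
rewrite !eqxx !oxx (oN a (dstar a)) mulrNN !(bilinNl Hf, bilinNr Hf) opprK.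
rewrite /tinnerr /tinnerl /touterr /touterl /tswap !mulrA.
rewrite !(sys_vf S, sys_fv S, sys_fy S,
  mul_rulel (sys_vf S a), mul_rulel (sys_fy S a)).
(* Either the sign between [a] and its star is zero, or [a] is a loop and the idempotents at its
   ends coincide. *)
case: (ot a (dstar a)) => [->|<-]; first by lmod_ring.
by rewrite !(sys_vf S); lmod_ring.
Qed.

Lemma flip_bracket f : bilin f -> forall c d,
  dbr br f (x' c) (x' d) = quiver_form e x' eps' o f c d.
Proof.
move=> Hf c d.
have epsN' c1 : eps' (dstar c1) = ~~ eps' c1.
  by rewrite epsN eq_dstar eq_dstarl orbC addNb.
have anti c1 d1 : dbr br (tswap f) (x' d1) (x' c1) =
    quiver_form e x' eps' o (tswap f) d1 c1 ->
    dbr br f (x' c1) (x' d1) = quiver_form e x' eps' o f c1 d1.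
  by move=> E; rewrite (dbr_anti DB) // E [RHS]quiver_form_anti.
have Hs := bilin_swap Hf.
have [->|ca] := eqVneq c a.
  have [->|da] := eqVneq d a; first by rewrite flip_gen_a flip_aa.
  have [->|das] := eqVneq d (dstar a).
    by rewrite flip_gen_a flip_gen_as flip_aas.
  by rewrite flip_gen_a (flip_genE da) flip_a_other.
have [->|da] := eqVneq d a.
  apply: anti; rewrite flip_gen_a (flip_genE ca).
  by have [->|cas] := eqVneq c (dstar a); rewrite ?flip_aas ?flip_a_other.
rewrite (flip_genE ca) (flip_genE da) HB //.
rewrite /quiver_form (flip_genE ca) (flip_genE da).
have [dc|] := eqVneq d (dstar c); last by rewrite !mul0r !scale0r.
have cas : c != dstar a by rewrite -eq_dstarl -dc.
by rewrite (negPf ca) (negPf cas) addbF /unit_elt dstarK !flip_genE // -dc.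
Qed.

End Flip.

End Moment.

(** * Algebra morphisms and naturality of the moves *)

Section Hom.
Variables (A R : algType K) (h : A -> R).
Hypothesis Hh : is_alg_hom h.

Lemma homM p q : h (p * q) = h p * h q.
Proof. by case: Hh. Qed.

Lemma hom1 : h 1 = 1.
Proof. by case: Hh. Qed.

Lemma homD p q : h (p + q) = h p + h q.
Proof. by case: Hh => /(_ 1 p q); rewrite !scale1r. Qed.

Lemma hom0 : h 0 = 0.
Proof. by apply: (addrI (h 0)); rewrite -homD !addr0. Qed.

Lemma homN p : h (- p) = - h p.
Proof. by apply: (addrI (h p)); rewrite -homD !subrr hom0. Qed.

Lemma hom_sum (J : Type) (r : seq J) (P : pred J) (F : J -> A) :
  h (\sum_(j <- r | P j) F j) = \sum_(j <- r | P j) h (F j).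
Proof. exact: (big_morph h homD hom0). Qed.

Lemma hom_prod (J : Type) (r : seq J) (P : pred J) (F : J -> A) :
  h (\prod_(j <- r | P j) F j) = \prod_(j <- r | P j) h (F j).
Proof. exact: (big_morph h homM hom1). Qed.

Lemma hom_comp (R' : algType K) (h' : R -> R') :
  is_alg_hom h' -> is_alg_hom (h' \o h).
Proof.
move=> [L M U]; case: Hh => L' M' U'.
by split=> *; rewrite /= ?L' ?L ?M' ?M ?U'.
Qed.

Lemma hom_system (e : I -> A) (x w : dbl Ar -> A) :
  quiver_system e x w -> quiver_system (h \o e) (h \o x) (h \o w).
Proof.
move=> [[ee e1] gx cw]; split=> [|c|c] /=.
- split=> [s s'|] /=; last by rewrite -hom_sum e1 hom1.
  by rewrite -homM ee; case: ifP => _; rewrite ?hom0.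
- by rewrite {1}gx !homM.
- case: (cw c) => cw1 cw2 cw3.
  by rewrite -!homM -homD -!homM cw2 cw3 {1}cw1 !homM.
Qed.

Section Natural.
Variables (e : I -> A) (x w : dbl Ar -> A).

Lemma hom_unit_elt c : h (unit_elt e x c) = unit_elt (h \o e) (h \o x) c.
Proof. by rewrite /unit_elt homD homM. Qed.

Lemma hom_unit_pow s c :
  h (unit_pow e x w s c) = unit_pow (h \o e) (h \o x) (h \o w) s c.
Proof. by rewrite /unit_pow -hom_unit_elt; case: s. Qed.

Lemma hom_swap_gen s a b c :
  h (swap_gen e x w s a b c) = swap_gen (h \o e) (h \o x) (h \o w) s a b c.
Proof.
by rewrite /swap_gen -!hom_unit_pow; do 2?case: ifP => _; rewrite ?homM.
Qed.

Lemma hom_flip_gen a c : h (flip_gen x w a c) = flip_gen (h \o x) (h \o w) a c.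
Proof. by rewrite /flip_gen; case: ifP => _; rewrite ?homN ?homM. Qed.

End Natural.
End Hom.

(** * The universal property, independent of orders and orientation *)

Definition quiver_localisation (A : algType K) (e : I -> A)
    (x w : dbl Ar -> A) :=
  quiver_system e x w /\
  forall (R : algType K) (f : I -> R) (y v : dbl Ar -> R),
    quiver_system f y v ->
    exists h : A -> R,
      [/\ is_alg_hom h, forall s, h (e s) = f s, forall c, h (x c) = y c &
        forall h' : A -> R, is_alg_hom h' -> (forall s, h' (e s) = f s) ->
          (forall c, h' (x c) = y c) -> h' =1 h].

(** Inverses are determined by the generators, so a morphism that matches generators also matches
    inverses. *)
Lemma system_inv_uniq (R : algType K) (f : I -> R) (y v v' : dbl Ar -> R) :
  quiver_system f y v -> quiver_system f y v' -> v = v'.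
Proof.
move=> S S'; apply: funext => c.
apply: (sys_inv_uniq S'); first exact: sys_vf S c.
exact: sys_vu S c.
Qed.

(* A localisation stays one under an invertible natural change [M] of
   generators, with inverse [N]; [M] and [N] act on the pair formed by the
   generators and the inverses of the elements [1 + y y*]. *)
Lemma localisation_change
    (M1 M2 N1 N2 : forall R : algType K,
       (I -> R) -> (dbl Ar -> R) -> (dbl Ar -> R) -> dbl Ar -> R)
    (A : algType K) (e : I -> A) (x w : dbl Ar -> A) :
  (forall (R : algType K) (f : I -> R) y v, quiver_system f y v ->
     quiver_system f (M1 R f y v) (M2 R f y v)) ->
  (forall (R : algType K) (f : I -> R) y v, quiver_system f y v ->
     quiver_system f (N1 R f y v) (N2 R f y v)) ->
  (forall (R R' : algType K) (h : R -> R'), is_alg_hom h -> forall f y v c,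
     h (M1 R f y v c) = M1 R' (h \o f) (h \o y) (h \o v) c) ->
  (forall (R R' : algType K) (h : R -> R'), is_alg_hom h -> forall f y v c,
     h (N1 R f y v c) = N1 R' (h \o f) (h \o y) (h \o v) c) ->
  (forall (R : algType K) (f : I -> R) y v, quiver_system f y v ->
     N1 R f (M1 R f y v) (M2 R f y v) =1 y) ->
  (forall (R : algType K) (f : I -> R) y v, quiver_system f y v ->
     M1 R f (N1 R f y v) (N2 R f y v) =1 y) ->
  quiver_localisation e x w ->
  quiver_localisation e (M1 A e x w) (M2 A e x w).
Proof.
move=> MS NS Mh Nh NM MN [S U]; split=> [|R f y v Sy]; first exact: MS.
have [h [Hh he hx hU]] := U R f _ _ (NS _ _ _ _ Sy).
have transp (h1 : A -> R) y1 v1 (x1 w1 : dbl Ar -> A) : is_alg_hom h1 ->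
    (forall s, h1 (e s) = f s) -> quiver_system f y1 v1 ->
    quiver_system e x1 w1 -> (forall c, h1 (x1 c) = y1 c) ->
    [/\ h1 \o e = f, h1 \o x1 = y1 & h1 \o w1 = v1].
  move=> Hh1 h1e S1 Sx1 h1x.
  have E : h1 \o e = f by exact: funext.
  have X : h1 \o x1 = y1 by exact: funext.
  split=> //; apply: system_inv_uniq S1.
  by rewrite -E -X; exact: hom_system.
exists h; split=> // [c|h' Hh' he' hx'].
  have [E X V] := transp h _ _ _ _ Hh he (NS _ _ _ _ Sy) S hx.
  by rewrite Mh // E X V MN.
(* Uniqueness: if [h'] sends the new generators to [y], it sends [x], recovered from them by [N1],
   to the image of [y] under [N1], as [h] does. *)
apply: hU => // c.
have [E X V] := transp h' _ _ _ _ Hh' he' Sy (MS _ _ _ _ S) hx'.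
by rewrite -(NM _ _ _ _ S) Nh // E X V.
Qed.

Lemma swap_localisation (A : algType K) (e : I -> A) (x w : dbl Ar -> A) s a b :
  tl a = tl b -> a != b -> quiver_localisation e x w ->
  quiver_localisation e (swap_gen e x w s a b) (swap_inv e x w s a b).
Proof.
move=> tab nab; apply: (@localisation_change
  (fun R f y v => swap_gen f y v s a b) (fun R f y v => swap_inv f y v s a b)
  (fun R f y v => swap_gen f y v (~~ s) a b)
  (fun R f y v => swap_inv f y v (~~ s) a b)).
- by move=> R f y v Sy; exact: swap_system.
- by move=> R f y v Sy; exact: swap_system.
- by move=> R R' h Hh f y v c; exact: hom_swap_gen.
- by move=> R R' h Hh f y v c; exact: hom_swap_gen.
- by move=> R f y v Sy; exact: swap_genK.
- move=> R f y v Sy c; have := @swap_genK _ _ _ _ Sy a b (~~ s) tab nab c.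
  by rewrite negbK.
Qed.

Lemma flip_localisation (A : algType K) (e : I -> A) (x w : dbl Ar -> A) a :
  quiver_localisation e x w ->
  quiver_localisation e (flip_gen x w a) (flip_inv e x w a).
Proof.
apply: (@localisation_change
  (fun R f y v => flip_gen y v a) (fun R f y v => flip_inv f y v a)
  (fun R f y v => flip_gen y v a) (fun R f y v => flip_inv f y v a)).
- by move=> R f y v Sy; exact: flip_system.
- by move=> R f y v Sy; exact: flip_system.
- by move=> R R' h Hh f y v c; exact: hom_flip_gen.
- by move=> R R' h Hh f y v c; exact: hom_flip_gen.
- by move=> R f y v Sy; exact: flip_genK.
- by move=> R f y v Sy; exact: flip_genK.
Qed.

(* An algebra with the universal property of the localisation has no proper
   subalgebra containing the generators and the inverses: by universality the
   identity factors through such a subalgebra. *)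
Section Induction.
Variables (A : algType K) (e : I -> A) (x w : dbl Ar -> A).
Hypothesis L : quiver_localisation e x w.
Variable P : A -> Prop.
Hypothesis P1 : P 1.
Hypothesis PD : forall k p q, P p -> P q -> P (k *: p + q).
Hypothesis PM : forall p q, P p -> P q -> P (p * q).
Hypothesis Pe : forall s, P (e s).
Hypothesis Px : forall c, P (x c).
Hypothesis Pw : forall c, P (w c).

Definition ind_pred : {pred A} := fun p => `[< P p >].

Fact ind_pred_closed : subalg_closed ind_pred.
Proof.
split; rewrite /ind_pred ?unfold_in; first exact/asboolP.
  by move=> k p q /asboolP Pp /asboolP Pq; apply/asboolP/PD.
by move=> p q /asboolP Pp /asboolP Pq; apply/asboolP/PM.
Qed.
HB.instance Definition _ :=
  GRing.isSubalgClosed.Build K A ind_pred ind_pred_closed.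

Record ind_alg := IndAlg { ind_val : A; ind_valP : ind_pred ind_val }.
HB.instance Definition _ := [isSub for ind_val].
HB.instance Definition _ := [Choice of ind_alg by <:].
HB.instance Definition _ := [SubChoice_isSubAlgebra of ind_alg by <:].

Lemma localisation_ind p : P p.
Proof.
pose lift q (Pq : P q) : ind_alg := IndAlg (asboolT Pq : ind_pred q).
have Hval : is_alg_hom (ind_val : ind_alg -> A).
  split=> [k p1 p2|p1 p2|]; last exact: (rmorph1 (\val : ind_alg -> A)).
    by rewrite -[LHS]/(val _) linearP.
  exact: (rmorphM (\val : ind_alg -> A)).
have val_inj : injective ind_val by exact: (@val_inj _ _ ind_alg).
have [S U] := L.
have S' : quiver_system (fun s => lift _ (Pe s)) (fun c => lift _ (Px c))
    (fun c => lift _ (Pw c)).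
  case: S => -[ee e1] gx cw; split.
  - split=> [s s'|]; apply: val_inj.
      by rewrite (homM Hval) /= ee; case: ifP => // _; rewrite (hom0 Hval).
    by rewrite (hom_sum Hval) (hom1 Hval).
  - by move=> c; apply: val_inj; rewrite !(homM Hval) /= -gx.
  - move=> c; case: (cw c) => cw1 cw2 cw3.
    by split; apply: val_inj; rewrite !(homM Hval) ?(homD Hval) ?(homM Hval).
have [h [Hh he hx _]] := U _ _ _ _ S'.
have [h1 [_ _ _ h1U]] := U _ _ _ _ S.
have E : p = ind_val (h p).
  (* The composite through the subalgebra and the identity both fix the generators, so both equal
     [h1]. *)
  have -> : ind_val (h p) = h1 p.
    apply: (h1U (ind_val \o h)) => [|s|c]; rewrite /= ?he ?hx //.
    exact: hom_comp.
  by apply: (h1U id).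
by rewrite E; apply/asboolP; exact: ind_valP.
Qed.

End Induction.

Lemma bilin_hom (A A' : algType K) (W : lmodType K) (h : A -> A')
    (f : A' -> A' -> W) : is_alg_hom h -> bilin f ->
  bilin (fun p q => f (h p) (h q)).
Proof. by move=> [L _ _] [H1 H2]; split=> *; rewrite L ?H1 ?H2. Qed.

(** * A bracket is determined by its values on generators *)

Section Agreement.
Variables (A A' : algType K) (e : I -> A) (e' : I -> A').
Variables (x w : dbl Ar -> A) (br : A -> A -> seq (A * A)).
Variables (br' : A' -> A' -> seq (A' * A')) (h : A -> A').
Hypothesis DB : double_bracket e br.
Hypothesis DB' : double_bracket e' br'.
Hypothesis L : quiver_localisation e x w.
Hypothesis Hh : is_alg_hom h.
Hypothesis he : forall s, h (e s) = e' s.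

Definition agree (p q : A) := forall (W : lmodType K) (f : A' -> A' -> W),
  bilin f ->
  dbr br' f (h p) (h q) = dbr br (fun y z => f (h y) (h z)) p q.

Lemma agree_sym p q : agree p q -> agree q p.
Proof.
move=> H W f Hf; rewrite (dbr_anti DB') // H; last exact: bilin_swap.
by rewrite [RHS](dbr_anti DB) //; exact: bilin_hom.
Qed.

Lemma dbr_eq_fun (B : algType K) (b : B -> B -> seq (B * B)) (W : lmodType K)
    (f1 f2 : B -> B -> W) p q :
  (forall y z, f1 y z = f2 y z) -> dbr b f1 p q = dbr b f2 p q.
Proof. by move=> E; congr (_ *: _); apply: eq_bigr => i _. Qed.

Lemma agreeM p q r : agree p q -> agree p r -> agree p (q * r).
Proof.
move=> Hq Hr W f Hf; have Hf' := bilin_hom Hh Hf.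
rewrite (homM Hh) (dbr_Mr DB') // (dbr_Mr DB) // Hq; last exact: bilin_outerr.
rewrite Hr; last exact: bilin_outerl.
by congr (_ + _); apply: dbr_eq_fun => y z; rewrite /touterr /touterl (homM Hh).
Qed.

Lemma agreeD p k q r : agree p q -> agree p r -> agree p (k *: q + r).
Proof.
move=> Hq Hr W f Hf; have Hf' := bilin_hom Hh Hf; case: (Hh) => -> _ _.
by rewrite (dbr_linr DB') // (dbr_linr DB) // Hq // Hr.
Qed.

Lemma agree_e p s : agree p (e s).
Proof.
by move=> W f Hf; rewrite he (dbr_er DB') // (dbr_er DB) //; exact: bilin_hom.
Qed.

Lemma agree0 p : agree p 0.
Proof.
move=> W f Hf; have Hf' := bilin_hom Hh Hf; rewrite (hom0 Hh).
have := dbr_Nr DB' Hf (h p) 0; have := dbr_Dr DB' Hf (h p) 0 0.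
rewrite addr0 -[X in X = _]addr0 => /addrI <- _.
by have := dbr_Dr DB Hf' p 0 0; rewrite addr0 -[X in X = _]addr0 => /addrI.
Qed.

Lemma agree1 p : agree p 1.
Proof.
case: L => -[[_ <-] _ _] _; elim/big_rec: _ => [|s q _ Hq]; first exact: agree0.
by rewrite -[e s]scale1r; apply: agreeD => //; exact: agree_e.
Qed.

(** The bracket with an inverse is computed from the bracket with the unit, by the same formula on
    both sides of [h]. *)
Lemma agree_inv p c : agree p (x c) -> agree p (x (dstar c)) -> agree p (w c).
Proof.
move=> H1 H2; have [S _] := L.
have Hu : agree p (unit_elt e x c).
  rewrite /unit_elt -[e _]scale1r; apply: agreeD; first exact: agree_e.
  exact: agreeM.
move=> W f Hf; have Hf' := bilin_hom Hh Hf.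
rewrite (dbr_invr DB p Hf' (sys_uv S c) (sys_vu S c) (sys_fv S c)).
rewrite (@dbr_invr _ _ _ DB' _ f (tl c) (h p) (h (unit_elt e x c))) //;
  last first.
- by rewrite -he -(homM Hh) (sys_fv S).
- by rewrite -he -(homM Hh) (sys_vu S).
- by rewrite -he -(homM Hh) (sys_uv S).
congr (- _); rewrite Hu; last by apply: bilin_outerl; exact: bilin_outerr.
by apply: dbr_eq_fun => y z; rewrite /touterr /touterl !(homM Hh).
Qed.

(** For fixed [p] the elements that agree with it form a subalgebra, closed under the adjoined
    inverses. The induction is run first for [p] a generator and then, after antisymmetry, for any
    [p]. *)
Lemma agree_all : (forall c d, agree (x c) (x d)) -> forall p q, agree p q.
Proof.
move=> H; have step p : (forall d, agree p (x d)) -> forall q, agree p q.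
  move=> Hp; apply: (localisation_ind L).
  - exact: agree1.
  - by move=> k q r; exact: agreeD.
  - by move=> q r; exact: agreeM.
  - by move=> s; exact: agree_e.
  - exact: Hp.
  - by move=> c; apply: agree_inv.
by move=> p; apply: (step p) => d; apply: agree_sym; exact: (step (x d)).
Qed.

End Agreement.

Lemma localisation_iso (A A' : algType K) (e : I -> A) (e' : I -> A')
    (x w : dbl Ar -> A) (x' w' : dbl Ar -> A') :
  quiver_localisation e x w -> quiver_localisation e' x' w' ->
  exists h : A -> A', [/\ is_alg_hom h, bijective h, forall s, h (e s) = e' s,
    forall c, h (x c) = x' c & forall c, h (w c) = w' c].
Proof.
move=> [S U] [S' U'].
have [h [Hh he hx _]] := U _ _ _ _ S'.
have [h' [Hh' he' hx' _]] := U' _ _ _ _ S.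
have [k [_ _ _ kU]] := U _ _ _ _ S; have [k' [_ _ _ kU']] := U' _ _ _ _ S'.
have hK : h' \o h =1 k.
  by apply: kU => [|s|c] /=; [exact: hom_comp | rewrite he he' | rewrite hx hx'].
have hK' : h \o h' =1 k'.
  by apply: kU' => [|s|c] /=; [exact: hom_comp | rewrite he' he | rewrite hx' hx].
have idk : id =1 k by apply: kU.
have idk' : id =1 k' by apply: kU'.
exists h; split=> //.
- by exists h' => p; [exact: etrans (hK p) (esym (idk p)) |
    exact: etrans (hK' p) (esym (idk' p))].
(* The images of the [w c] invert the units of [x'], hence are the [w' c]. *)
- have S2 := hom_system Hh S.
  have E : h \o e = e' by exact: funext.
  have X : h \o x = x' by exact: funext.
  move=> c; rewrite E X in S2.
  by rewrite -[LHS]/((h \o w) c) (system_inv_uniq S2 S').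
Qed.

(** * Vertex orders and their signs *)

Definition vertex_enum (ord : I -> seq (dbl Ar)) :=
  forall s, uniq (ord s) /\ forall c, (c \in ord s) = (tl c == s).

(** The vertex is taken to be the tail of [b]; the value is zero unless [c] starts there too. *)
Definition vsign (ord : I -> seq (dbl Ar)) (b c : dbl Ar) : K :=
  ordo K ord (tl b) b c.

Section Orders.
Variable ord : I -> seq (dbl Ar).
Hypothesis Hord : vertex_enum ord.

Lemma vsignE b c : vsign ord b c =
  if (tl b == tl c) && (b != c) then
    if (index b (ord (tl b)) < index c (ord (tl b)))%N then 1 else -1
  else 0.
Proof.
have [_ H] := Hord (tl b).
by rewrite /vsign /ordo !H eqxx [tl c == _]eq_sym.
Qed.

Lemma vsign_vertex_sign : vertex_sign (vsign ord).
Proof.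
split=> [b|b c|b c]; rewrite !vsignE; first by rewrite !eqxx.
- rewrite [tl c == _]eq_sym [c == b]eq_sym.
  have [tbc|_] := eqVneq (tl b) (tl c); last by rewrite oppr0.
  have [_|nbc] := eqVneq b c; first by rewrite oppr0.
  rewrite -tbc /=; case: ltngtP => [||E]; rewrite ?opprK //.
  have [_ H] := Hord (tl b); case/eqP: nbc.
  by apply: (index_inj b _ _ (esym E)); rewrite H ?tbc.
- by case: eqP => [->|]; [right | left].
Qed.

End Orders.

Section SwapOrder.
Variables (T : eqType) (l1 l2 : seq T) (a b : T).
Notation l := (l1 ++ [:: a, b & l2]).
Notation l' := (l1 ++ [:: b, a & l2]).
Hypothesis Ul : uniq l.

Lemma swap_neq : a != b.
Proof.
by move: Ul; rewrite cat_uniq => /and3P[_ _] /=; rewrite inE => /andP[/norP[]].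
Qed.

Lemma swap_index_a : index a l = size l1.
Proof.
move: Ul; rewrite cat_uniq /= => /and3P[_ /norP[al1 _] _].
by rewrite index_cat (negPf al1) /= eqxx addn0.
Qed.

Lemma swap_index_b : index b l = (size l1).+1.
Proof.
move: Ul; rewrite cat_uniq /= => /and3P[_ /norP[_ /norP[bl1 _]] _].
by rewrite index_cat (negPf bl1) /= (negPf swap_neq) eqxx addn1.
Qed.

(** The index of [d] is either below [size l1] or at least [size l1 + 2], hence on the same side of
    both exchanged positions. *)
Lemma swap_index_other d : d != a -> d != b ->
  [/\ index d l' = index d l,
      ((size l1).+1 < index d l)%N = (size l1 < index d l)%N &
      (index d l < (size l1).+1)%N = (index d l < size l1)%N].
Proof.
move=> da db; rewrite !index_cat /= ![_ == d]eq_sym (negPf da) (negPf db).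
have [] := boolP (d \in l1); rewrite -?index_mem; last first.
  by move=> _; move: (index d l2) (size l1) => i n; split=> //; lia.
by move: (index d l1) (size l1) => i n ltin; split=> //; lia.
Qed.

End SwapOrder.

(** * Presentations of a fixed algebra with bracket and moment map *)

Section Presentation.
Variables (A : algType K) (e : I -> A) (br : A -> A -> seq (A * A)).
Hypothesis DB : double_bracket e br.
Variable Phi : I -> A.

(** The algebra, its bracket and [Phi] are fixed, while the generators are existentially quantified:
    each move replaces them. The factor [e s] gives the empty product its value. *)
Definition presented (eps : dbl Ar -> bool) (ord : I -> seq (dbl Ar)) :=
  exists x w : dbl Ar -> A, [/\ quiver_localisation e x w,
    is_quiver_bracket e x eps (vsign ord) br &
    forall s, e s * \prod_(c <- ord s) unit_pow e x w (eps c) c = Phi s].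

Lemma presented_flip eps ord a : (forall c, eps (dstar c) = ~~ eps c) ->
  vertex_enum ord -> eps a = false -> presented eps ord ->
  presented (fun c => eps c (+) ((c == a) || (c == dstar a))) ord.
Proof.
move=> epsN Hord epsa [x [w [L HB HP]]]; have [S _] := L.
exists (flip_gen x w a), (flip_inv e x w a); split.
- exact: flip_localisation.
- move=> W f Hf; apply: (flip_bracket S DB) => //.
  exact: vsign_vertex_sign.
(* At [a] and [dstar a] the exponent changes and the unit is exchanged with its inverse, so each
   factor of [Phi] is unchanged. *)
- move=> s; rewrite -HP; congr (_ * _); apply: eq_bigr => c _.
  by rewrite flip_pow // -addbA addbb addbF.
Qed.

Lemma presented_swap eps ord ord' s0 l1 a b l2 :
  (forall c, eps (dstar c) = ~~ eps c) ->
  vertex_enum ord -> vertex_enum ord' ->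
  ord s0 = l1 ++ [:: a, b & l2] -> ord' s0 = l1 ++ [:: b, a & l2] ->
  (forall s, s != s0 -> ord' s = ord s) ->
  presented eps ord -> presented eps ord'.
Proof.
move=> epsN Hord Hord' E0 E0' E [x [w [L HB HP]]]; have [S _] := L.
have [U Hs0] := Hord s0; have [U' Hs0'] := Hord' s0.
rewrite E0 in U; rewrite E0' in U'.
have nab := swap_neq U.
have ta : tl a = s0 by apply/eqP; rewrite -Hs0 E0 mem_cat !inE eqxx orbT.
have tb : tl b = s0 by apply/eqP; rewrite -Hs0 E0 mem_cat !inE eqxx !orbT.
have tab : tl a = tl b by rewrite ta tb.
exists (swap_gen e x w (eps a) a b), (swap_inv e x w (eps a) a b); split.
- exact: swap_localisation.
- move=> W f Hf; have Vs := vsign_vertex_sign Hord.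
  have Vs' := vsign_vertex_sign Hord'.
  apply: (swap_bracket S DB epsN Vs HB tab nab _ _ Vs') => //.
  + rewrite vsignE // tab eqxx nab tb E0 (swap_index_a U) (swap_index_b U).
    by rewrite leqnn.
  + move=> d da db; rewrite !vsignE // tab ![_ == d :> dbl Ar]eq_sym da db tb.
    case: ifP => // _; rewrite E0 (swap_index_a U) (swap_index_b U).
    by case: (swap_index_other U da db) => _ ->.
  + rewrite vsignE // tab eqxx eq_sym nab tb E0'.
    by rewrite (swap_index_a U') (swap_index_b U') leqnn.
  + move=> c d; rewrite !vsignE //; have [tcd|//] := eqVneq (tl c) (tl d).
    have [//|ncd] := eqVneq c d; rewrite /=.
    have [tc|tc] := eqVneq (tl c) s0; last by rewrite E.
    rewrite tc E0 E0'.
    have iab :=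
      (swap_index_a U, swap_index_b U, swap_index_a U', swap_index_b U').
    have [ca|ca] := eqVneq c a; last have [cb|cb] := eqVneq c b.
    * rewrite ca in ncd *; have [db|db] := eqVneq d b; first by [].
      move=> _ _; have da : d != a by rewrite eq_sym.
      by case: (swap_index_other U da db) => ->; rewrite !iab => ->.
    * rewrite cb in ncd *; have [da|da] := eqVneq d a; first by [].
      move=> _ _; have db : d != b by rewrite eq_sym.
      by case: (swap_index_other U da db) => ->; rewrite !iab => ->.
    * move=> _ _; case: (swap_index_other U ca cb) => -> _ Hc.
      have [->|da] := eqVneq d a; last have [->|db] := eqVneq d b; last first.
      - by case: (swap_index_other U da db) => ->.
      - by rewrite !iab Hc.
      - by rewrite !iab Hc.
- move=> s; rewrite -HP; have [->|ns] := eqVneq s s0; last first.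
    rewrite (E s ns); congr (_ * _); apply: eq_big_seq => c.
    have [_ ->] := Hord s; move/eqP=> tc; rewrite swap_pow //.
    by case: eqP => // cb; case/eqP: ns; rewrite -tc cb.
  rewrite E0 E0' !big_cat !big_cons /=; congr (_ * _).
  move: (U); rewrite cat_uniq /= => /and3P[_ /norP[_ /norP[bl1 _]]].
  case/and3P=> [_ bl2 _]; congr (_ * _).
    apply: eq_big_seq => c cl; rewrite swap_pow //; case: eqP => // cb.
    by rewrite -cb cl in bl1.
  rewrite !mulrA; congr (_ * _); last first.
    apply: eq_big_seq => c cl; rewrite swap_pow //; case: eqP => // cb.
    by rewrite -cb cl in bl2.
  (* The new factors, in the new order, are $\phi_a\phi_b\phi_a^{-1}$ and $\phi_a$, with product
     $\phi_a\phi_b$. *)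
  rewrite !swap_pow // eqxx (negPf nab) -!mulrA (sys_gNl S).
  by rewrite tab (sys_gf S).
Qed.

(** Adjacent transpositions suffice to sort: the entries of [t] are brought into place one after the
    other. *)
Lemma perm_eq_adjacent (T : eqType) (P : seq T -> Prop) :
  (forall l1 a b l2, uniq (l1 ++ [:: a, b & l2]) ->
     P (l1 ++ [:: a, b & l2]) -> P (l1 ++ [:: b, a & l2])) ->
  forall s t, uniq s -> perm_eq s t -> P s -> P t.
Proof.
move=> step.
have front l c s1 s2 : uniq (l ++ s1 ++ c :: s2) ->
    P (l ++ s1 ++ c :: s2) -> P (l ++ c :: s1 ++ s2).
  elim/last_ind: s1 s2 => // s1 d IH s2; rewrite -!cats1 -!catA /= => U Pd.
  apply: IH; last by rewrite catA; apply: step; rewrite -catA.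
  rewrite -(perm_uniq (s1 := l ++ s1 ++ [:: d, c & s2])) //.
  by rewrite !perm_cat2l (perm_catCA [:: d] [:: c] s2).
(* The prefix [l] is the part of the target already reached. *)
suff gen t l s : uniq (l ++ s) -> perm_eq s t -> P (l ++ s) -> P (l ++ t).
  by move=> s t U E; exact: (gen t [::] s).
elim: t l s => [|c t IH] l s U E Ps; first by rewrite (perm_nilP E) in Ps.
have : c \in s by rewrite (perm_mem E) mem_head.
move: E Ps U => + + + /splitPr cs; case: cs => s1 s2 E Ps U.
rewrite -cat_rcons; apply: (IH _ (s1 ++ s2)).
- rewrite cat_rcons -(perm_uniq (s1 := l ++ s1 ++ c :: s2)) //.
  by rewrite perm_cat2l (perm_catCA s1 [:: c] s2).
- by move: E; rewrite (perm_catCA s1 [:: c] s2) perm_cons.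
- by rewrite cat_rcons; exact: front.
Qed.

Lemma presented_order eps ord ord' : (forall c, eps (dstar c) = ~~ eps c) ->
  vertex_enum ord -> vertex_enum ord' -> presented eps ord -> presented eps ord'.
Proof.
move=> epsN Hord Hord' HP.
(* The target order is used at the vertices of [r] and the initial one elsewhere; induction on [r]
   treats one vertex at a time. *)
pose mix (r : seq I) s := if s \in r then ord' s else ord s.
have mixP r : vertex_enum (mix r) by move=> s; rewrite /mix; case: ifP.
suff H r : presented eps (mix r).
  rewrite (_ : ord' = mix (enum I)) //.
  by apply: funext => s; rewrite /mix mem_enum.
elim: r => [|s0 r IH]; first exact: HP.
pose put l s := if s == s0 then l else mix r s.
have -> : mix (s0 :: r) = put (ord' s0).
  by apply: funext => s; rewrite /mix /put /mix inE; case: eqP => [->|].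
pose ok l := uniq l /\ forall c, (c \in l) = (tl c == s0).
have putP l : ok l -> vertex_enum (put l).
  by move=> okl s; rewrite /put; case: eqP => [->|_]; [exact: okl | exact: mixP].
(* Validity of the list is carried along, since an exchange needs an enumeration before and after
   it. *)
pose Q l := ok l /\ presented eps (put l).
suff [] : Q (ord' s0) by [].
apply: (@perm_eq_adjacent _ Q _ (mix r s0)).
- move=> l1 a b l2 _ [okl Pl]; have okl' : ok (l1 ++ [:: b, a & l2]).
    have E : perm_eq (l1 ++ [:: a, b & l2]) (l1 ++ [:: b, a & l2]).
      by rewrite perm_cat2l (perm_catCA [:: a] [:: b] l2).
    by case: okl => U M; split=> [|c]; rewrite -?(perm_uniq E) -?(perm_mem E).
  split=> //.
  by apply: (@presented_swap eps _ _ s0 l1 a b l2 epsN (putP _ okl)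
    (putP _ okl') _ _ _ Pl); rewrite /put ?eqxx // => s /negPf->.
- by case: (mixP r s0).
- have [U M] := mixP r s0; have [U' M'] := Hord' s0.
  by apply: uniq_perm => // c; rewrite M M'.
- split; first exact: mixP.
  rewrite (_ : put _ = mix r) //.
  by apply: funext => s; rewrite /put; case: eqP => // ->.
Qed.

Lemma presented_orientation eps eps' ord :
  (forall c, eps (dstar c) = ~~ eps c) ->
  (forall c, eps' (dstar c) = ~~ eps' c) ->
  vertex_enum ord -> presented eps ord -> presented eps' ord.
Proof.
move=> epsN epsN' Hord HP.
pose mix (r : seq Ar) (c : dbl Ar) := if c.1 \in r then eps' c else eps c.
have mixN r c : mix r (dstar c) = ~~ mix r c by rewrite /mix; case: ifP.
suff H r : presented (mix r) ord.
  rewrite (_ : eps' = mix (enum Ar)) //.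
  by apply: funext => c; rewrite /mix mem_enum.
elim: r => [|a0 r IH]; first exact: HP.
have sideE (f : dbl Ar -> bool) a1 : (forall c, f (dstar c) = ~~ f c) ->
    forall t, f (a1, t) = f (a1, false) (+) t.
  by move=> fN [] //; rewrite ?addbF // addbT -fN.
have side1 := sideE (mix (a0 :: r)) a0 (mixN _).
have side0 := sideE (mix r) a0 (mixN _).
have [E|N] := eqVneq (mix (a0 :: r) (a0, false)) (mix r (a0, false)).
  rewrite (_ : mix (a0 :: r) = mix r) //; apply: funext => -[a1 t].
  have [->|n] := eqVneq a1 a0; first by rewrite (side1 t) (side0 t) E.
  by rewrite /mix inE /= (negPf n).
(* The half of the arrow [a0] that is unstarred for the current orientation, as reversal
   requires. *)
pose a : dbl Ar := (a0, mix r (a0, false)).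
have aF : mix r a = false by rewrite side0 addbb.
rewrite (_ : mix (a0 :: r) = fun c => mix r c (+) ((c == a) || (c == dstar a))).
  exact: presented_flip.
apply: funext => -[a1 t]; rewrite !xpair_eqE /=.
have [->|n] := eqVneq a1 a0; last by rewrite addbF /mix inE /= (negPf n).
rewrite (side1 t) (side0 t).
by move: N; case: (mix _ _); case: (mix _ _); case: t.
Qed.

End Presentation.

(** The universal property gives an isomorphism matching generators and inverses; the brackets then
    agree on generators, hence everywhere, and the two moment maps are the same expression. *)
Lemma presented_iso (A A' : algType K) (e : I -> A) (e' : I -> A')
    (br : A -> A -> seq (A * A)) (br' : A' -> A' -> seq (A' * A'))
    (Phi : I -> A) (Phi' : I -> A') eps ord :
  (2 : K) != 0 ->
  double_bracket e br -> double_bracket e' br' ->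
  presented e br Phi eps ord -> presented e' br' Phi' eps ord ->
  exists psi : A -> A', qHam_iso e br Phi e' br' Phi' psi.
Proof.
move=> K2 DB DB' [x [w [L HB HP]]] [x' [w' [L' HB' HP']]].
have [h [Hh bh he hx hw]] := localisation_iso L L'.
have Eu c : h (unit_elt e x c) = unit_elt e' x' c.
  by rewrite /unit_elt (homD Hh) (homM Hh) he !hx.
exists h; split=> //.
- have agr : forall p q, agree br br' h p q.
    apply: (agree_all DB DB' L Hh he) => c d W f Hf.
    rewrite !hx HB' // HB; last exact: bilin_hom.
    by rewrite /quiver_form !(homM Hh) !hx !he !Eu.
  move=> p q W f Hf; apply: (scalerI K2); rewrite big_map.
  exact: agr.
- rewrite (hom_sum Hh); apply: eq_bigr => s _; rewrite -HP -HP' (homM Hh) he.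
  rewrite (hom_prod Hh); congr (_ * _); apply: eq_bigr => c _.
  by rewrite /unit_pow; case: (eps c).
Qed.

End HalfEdges.

(** * From the algebras $A_Q$ to presentations *)

Lemma AQ_localisation (K : fieldType) (I Ar : finType) (tQ hQ : Ar -> I)
    (A : algType K) (e : I -> A) (x w : dbl Ar -> A) :
  is_AQ tQ hQ e x w -> quiver_localisation (dt tQ hQ) e x w.
Proof.
have dhE c : dh tQ hQ c = dt tQ hQ (dstar c) by case: c => c [].
move=> [HB Hg Hc U]; split=> [|R f y v [Bf gy cy]].
  by split=> // c; rewrite -dhE; exact: Hg.
apply: U => //; last by exists v.
by move=> c; rewrite dhE.
Qed.

Lemma quiver_bracket_form (K : fieldType) (I Ar : finType) (tQ hQ : Ar -> I)
    (ord : I -> seq (dbl Ar)) (A : algType K) (e : I -> A) (x : dbl Ar -> A)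
    (br : A -> A -> seq (A * A)) :
  (2 : K) != 0 -> vertex_orders tQ hQ ord -> double_bracket e br ->
  quiver_bracket tQ hQ e x ord br ->
  is_quiver_bracket (dt tQ hQ) e x snd (vsign K (dt tQ hQ) ord) br.
Proof.
move=> K2 Hord DB [Haa Has Hbc].
set tl := dt tQ hQ; set o := vsign K tl ord.
have dhE c : dh tQ hQ c = tl (dstar c) by case: c => c [].
have Vs : vertex_sign tl o by exact: (@vsign_vertex_sign K I Ar tl ord Hord).
have [oxx oN _] := Vs.
have h2 : 2 * (1 / 2) = 1 :> K by rewrite mulrCA divff ?mulr1.
have h2z z : 2 * (1 / 2 * z) = z :> K by rewrite mulrA h2 mul1r.
have oE b c : ordo K ord (tl b) b c = o b c by [].
(* The given formula covers unstarred [b]; the starred case follows from it by antisymmetry. *)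
have star (W : lmodType K) (f : A -> A -> W) b : bilin f -> b.2 = false ->
    dbr br f (x b) (x (dstar b)) = quiver_form tl e x snd o f b (dstar b).
  case: b => a0 [] // Hf _; have /= := Has a0 _ _ Hf.
  set b : dbl Ar := (a0, false); have Eb : b.2 = false by [].
  rewrite /dbr => ->; clearbody b; rewrite !big_cons big_nil /= -/tl dhE !oE.
  rewrite !(bilinZl Hf) /quiver_form /unit_elt.
  rewrite eqxx dstarK !oxx (oN b (dstar b)) Eb !(bilinDl Hf) !(bilinDr Hf).
  by rewrite !scalerDr !scalerA ?mulrN !h2z ?h2; lmod_ring.
move=> W f Hf b c.
have [->|cb] := eqVneq c b; last have [->|cbs] := eqVneq c (dstar b).
- rewrite /dbr (Haa b _ _ Hf) !big_cons big_nil /= -/tl dhE oE.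
  rewrite !(bilinZl Hf) /quiver_form !oxx (oN b (dstar b)).
  rewrite [b == dstar b]eq_sym dstar_neq.
  by rewrite !scalerDr !scalerA ?mulrN !h2z ?h2; lmod_ring.
- case Eb : b.2; last exact: star.
  rewrite (dbr_anti DB) // quiver_form_anti //.
  rewrite -[X in dbr _ _ _ (x X)](dstarK b) star ?dstarK //.
    exact: bilin_swap.
  by rewrite /= Eb.
- rewrite /dbr (Hbc b c cb cbs _ _ Hf) !big_cons big_nil /= -/tl dhE !oE.
  rewrite !(bilinZl Hf) /quiver_form (negPf cbs).
  by rewrite !scalerDr !scalerA ?mulrN !h2z ?h2; lmod_ring.
Qed.

Lemma AQ_presented (K : fieldType) (I Ar : finType) (tQ hQ : Ar -> I)
    (ord : I -> seq (dbl Ar)) (A : algType K) (e : I -> A) (x w : dbl Ar -> A)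
    (br : A -> A -> seq (A * A)) :
  (2 : K) != 0 -> vertex_orders tQ hQ ord -> is_AQ tQ hQ e x w ->
  quiver_bracket tQ hQ e x ord br -> double_bracket e br ->
  presented (dt tQ hQ) e br (PhiQ e x w ord) snd ord.
Proof.
move=> K2 Hord HA Hbr DB; exists x, w; split.
- exact: AQ_localisation.
- exact: quiver_bracket_form.
- move=> s; congr (_ * _); apply: eq_big_seq => c.
  by have [_ ->] := Hord s => /eqP <-.
Qed.

(** Relabelling the half-edges by a bijection compatible with stars and tails. The orientation is
    pulled back, so it may differ from the standard one [snd]. *)
Lemma presented_transport (K : fieldType) (I Ar Ar' : finType)
    (tl : dbl Ar -> I) (tl' : dbl Ar' -> I) (tau : dbl Ar -> dbl Ar')
    (tau' : dbl Ar' -> dbl Ar) (A : algType K) (e : I -> A)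
    (br : A -> A -> seq (A * A)) (Phi : I -> A) eps ord :
  cancel tau tau' -> cancel tau' tau ->
  (forall c, tau (dstar c) = dstar (tau c)) -> (forall c, tl' (tau c) = tl c) ->
  presented tl' e br Phi eps ord ->
  presented tl e br Phi (eps \o tau) (fun s => map tau' (ord s)).
Proof.
move=> tauK tauK' tauS tauT [x [w [[S U] HB HP]]].
have tauS' c : tau' (dstar c) = dstar (tau' c).
  by apply: (can_inj tauK); rewrite tauS !tauK'.
have tauT' c : tl (tau' c) = tl' c by rewrite -tauT tauK'.
have tau_eq c d : (tau c == tau d) = (c == d) by exact: (can_eq tauK).
exists (x \o tau), (w \o tau); split.
- split=> [|R f y v [Bf gy cy]].
    by case: S => Be gx cw; split=> // c; rewrite /= -!tauT ?tauS.
  have [|h [Hh he hx hU]] := U R f (y \o tau') (v \o tau').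
    by split=> // c; rewrite /= -!tauT' ?tauS'.
  exists h; split=> // [c|h' Hh' he' hx']; first by rewrite /= hx /= tauK.
  by apply: hU => // c; rewrite /= -hx' /= tauK'.
- move=> W f Hf b c; rewrite /= HB //.
  have inj := can_inj tauK'.
  have E' b1 c1 : vsign K tl (fun s => map tau' (ord s)) (tau' b1) (tau' c1) =
      vsign K tl' ord b1 c1.
    by rewrite /vsign /ordo !(mem_map inj) !(index_map inj) tauT' (inj_eq inj).
  have E b1 c1 : vsign K tl (fun s => map tau' (ord s)) b1 c1 =
      vsign K tl' ord (tau b1) (tau c1) by rewrite -E' !tauK.
  have Eq : (tau c == dstar (tau b)) = (c == dstar b) by rewrite -tauS tau_eq.
  by rewrite /quiver_form /unit_elt !E /= -!tauT !tauS Eq.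
- move=> s; rewrite -HP big_map; congr (_ * _); apply: eq_bigr => c _.
  by rewrite /unit_pow /unit_elt /= tauS !tauK' tauT'.
Qed.

Theorem mainTheorem2 (K : fieldType) (charK0 : [pchar K] =i pred0)
  (I Ar Ar' : finType) (tQ hQ : Ar -> I) (tQ' hQ' : Ar' -> I)
  (sigma : Ar -> Ar') (sigma_bij : bijective sigma)
  (sigma_ends : forall a : Ar,
     ((tQ' (sigma a) == tQ a) && (hQ' (sigma a) == hQ a)) ||
     ((tQ' (sigma a) == hQ a) && (hQ' (sigma a) == tQ a)))
  (ord : I -> seq (dbl Ar)) (ord' : I -> seq (dbl Ar'))
  (Hord : vertex_orders tQ hQ ord) (Hord' : vertex_orders tQ' hQ' ord')
  (A A' : algType K)
  (e : I -> A) (x w : dbl Ar -> A) (e' : I -> A') (x' w' : dbl Ar' -> A')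
  (HA : is_AQ tQ hQ e x w) (HA' : is_AQ tQ' hQ' e' x' w')
  (br : A -> A -> seq (A * A)) (br' : A' -> A' -> seq (A' * A'))
  (Hbr : quiver_bracket tQ hQ e x ord br)
  (Hbr' : quiver_bracket tQ' hQ' e' x' ord' br')
  (HqH : quasi_Hamiltonian e br (PhiQ e x w ord))
  (HqH' : quasi_Hamiltonian e' br' (PhiQ e' x' w' ord')) :
  exists psi : A -> A',
    qHam_iso e br (PhiQ e x w ord) e' br' (PhiQ e' x' w' ord') psi.
Proof.
have K2 : (2 : K) != 0 by have := charK0 2; rewrite !inE /= => /negbT.
have [[DB _] _] := HqH; have [[DB' _] _] := HqH'.
have P := AQ_presented K2 Hord HA Hbr DB.
have P' := AQ_presented K2 Hord' HA' Hbr' DB'.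
have [sigma' sigmaK sigmaK'] := sigma_bij.
(* [same a] tells whether [sigma] keeps the direction of [a]; if not, [tau] exchanges the two halves
   of [a], so that tails are preserved. *)
pose same a := (tQ' (sigma a) == tQ a) && (hQ' (sigma a) == hQ a).
pose tau (c : dbl Ar) : dbl Ar' := (sigma c.1, c.2 (+) ~~ same c.1).
pose tau' (c : dbl Ar') : dbl Ar := (sigma' c.1, c.2 (+) ~~ same (sigma' c.1)).
have tauK : cancel tau tau'.
  by move=> [a t]; rewrite /tau /tau' /= sigmaK -addbA addbb addbF.
have tauK' : cancel tau' tau.
  by move=> [a t]; rewrite /tau /tau' /= sigmaK' -addbA addbb addbF.
have tauS c : tau (dstar c) = dstar (tau c) by rewrite /tau /dstar /= addNb.
have tauT c : dt tQ' hQ' (tau c) = dt tQ hQ c.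
  case: c => a t; rewrite /dt /tau /=; have := sigma_ends a; rewrite -/(same a).
  have [|_ /= /andP[/eqP-> /eqP->]] := boolP (same a); last by case: t.
  by rewrite /same => /andP[/eqP-> /eqP->] _; rewrite addbF.
(* Both algebras now live over the half-edges of the first quiver. It remains to move the
   presentation of [A] to the orientation and orders of the second. *)
have T' := presented_transport tauK tauK' tauS tauT P'.
apply: (presented_iso K2 DB DB' _ T').
apply: (presented_order DB _ Hord).
- by move=> c; rewrite /= addNb.
- move=> s; have [U M] := Hord' s; split=> [|c].
    by rewrite map_inj_uniq //; exact: can_inj tauK'.
  by rewrite -{1}(tauK c) (mem_map (can_inj tauK')) M tauT.
- apply: (presented_orientation DB _ _ Hord P) => c //.
  by rewrite /= addNb.
Qed.
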